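(* Let $Q$ be a finite quiver and let $\mathscr{C}$ be a finite, full, acyclic subcategory of $\downarrow\! Q$ such that every object of $\mathscr{C}$ is a connected quiver whose structure map is a wrapping, $\mathscr{C}$ is closed under fiber products, and for all objects $x,y$ of $\mathscr{C}$, the representation $L(x)$ is indecomposable in $\mathrm{rep}(Q)$ and $L(x)\not\simeq L(y)$ if $x\neq y$. Then: (1) The subring of $R(Q)$ generated by $L(\mathscr{C})=\{L(x):x\in\mathscr{C}\}$ has a ($\mathbb{Z}$-)basis of orthogonal idempotents \[ B=\{L(\delta_x)\mid x\in\mathscr{C}\}. \] (2) When $(Q,\mathrm{id})\in\mathscr{C}$, this results in a direct product decomposition of rings \[ R(Q)\cong\prod_{x\in\mathscr{C}}\langle L(\delta_x)\rangle, \] where $\langle L(\delta_x)\rangle$ is the principal ideal of $R(Q)$ generated by $L(\delta_x)$.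
   Context: Quivers are finite: $Q=(Q_0,Q_1,s,t)$. Fix a field $K$; $\mathrm{rep}(Q)$ is the category of finite dimensional representations of $Q$ over $K$. Representation ring: $R(Q)$ is the free abelian group on isomorphism classes $[V]$ of representations of $Q$, modulo the subgroup generated by all $[V\oplus W]-[V]-[W]$, with multiplication $[V][W]=[V\otimes W]$, where $\otimes$ is pointwise (tensor product of spaces at vertices and of maps over arrows). ''Subring'' means a nonempty subset closed under subtraction and multiplication (possibly with a different identity element). Quivers over $Q$: a morphism of quivers sends vertices to vertices and arrows to arrows, compatibly with $s,t$. A quiver over $Q$ is a pair $(Q',f')$ with $f'\colon Q'\to Q$ a morphism of quivers (structure map); morphisms are morphisms of quivers commuting with structure maps. This category is $\downarrow\! Q$. Wrapping: $f'\colon Q'\to Q$ is a wrapping if for every pair $i',j'\in Q'_0$ the induced map from arrows $i'\to j'$ to arrows $f'(i')\to f'(j')$ is injective. Linearization: $L(Q',f')\in\mathrm{rep}(Q)$ has at $x\in Q_0$ the vector space with basis $\{b_v: v\in Q'_0,\ f'(v)=x\}$, and the map over $\alpha\in Q_1$ is $\sum_{\beta\in f'^{-1}(\alpha)}\varphi_\beta$, where $\varphi_\beta$ sends $b_{s(\beta)}$ to $b_{t(\beta)}$ and all other basis vectors to $0$. Fiber product: the categorical product in $\downarrow\! Q$; $(Q',f')\times_Q(Q'',f'')$ has vertices the pairs $(x',x'')$ with $f'(x')=f''(x'')$ and an arrow $(\alpha',\alpha'')\colon(x',x'')\to(y',y'')$ for each pair of arrows $\alpha'\colon x'\to y'$,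 $\alpha''\colon x''\to y''$ with $f'(\alpha')=f''(\alpha'')$. $\mathscr{C}$ is closed under fiber products if the fiber product of any two objects of $\mathscr{C}$ is isomorphic to a (possibly empty) disjoint union of objects of $\mathscr{C}$. Acyclic category: a small category whose only endomorphisms are identities and in which only identity morphisms are invertible. For a finite acyclic category $\mathscr{C}$ with object set $\mathscr{C}_0$, $[x,y]$ is the number of morphisms $x\to y$, and the Möbius function $\mu\colon\mathscr{C}_0\times\mathscr{C}_0\to\mathbb{Z}$ is the inverse matrix of $([x,y])_{x,y}$, i.e. $\sum_z[x,z]\mu(z,y)$ equals $1$ if $x=y$ and $0$ otherwise. In the free abelian group on $\mathscr{C}_0$ put $\delta_x=\sum_{z\in\mathscr{C}_0}\mu(z,x)z$, and extend $L$ additively to a map from this group to $R(Q)$, so $L(\delta_x)=\sum_z\mu(z,x)L(z)$. *)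

(* Defs.v *)
From HB Require Import structures.
From mathcomp Require Import all_boot all_order all_algebra.
From mathcomp Require Import generic_quotient ring_quotient.
From mathcomp Require Import boolp classical_sets.
From mathcomp Require Import mxtens.
From mathcomp Require Import freeg.

Set Implicit Arguments.
Unset Strict Implicit.
Unset Printing Implicit Defensive.

Import GRing.Theory.
Local Open Scope ring_scope.
Local Open Scope quotient_scope.

(******************************************************************************)
(* Finite quivers                                                             *)
(******************************************************************************)

Record quiver := Quiver {
  vert : finType;
  arr : finType;
  src : arr -> vert;
  tgt : arr -> vert }.

Arguments src {q} _.
Arguments tgt {q} _.

Definition adjacent (Q : quiver) : rel (vert Q) := fun u v =>
  [exists a : arr Q, ((src a == u) && (tgt a == v))
                  || ((src a == v) && (tgt a == u))].

(* The empty quiver is not connected. *)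
Definition connected_quiver (Q : quiver) : Prop :=
  (0 < #|vert Q|)%N /\ forall u v : vert Q, connect (@adjacent Q) u v.

Section QuiverMorphisms.

Definition is_qmor (A B : quiver)
    (f : {ffun vert A -> vert B} * {ffun arr A -> arr B}) : bool :=
  [forall a, (src (f.2 a) == f.1 (src a)) && (tgt (f.2 a) == f.1 (tgt a))].

(* A finType, so that morphisms can be counted. *)
Definition qmor (A B : quiver) :=
  {f : {ffun vert A -> vert B} * {ffun arr A -> arr B} | is_qmor f}.

Definition mvert A B (f : qmor A B) : vert A -> vert B := (val f).1.
Definition marr A B (f : qmor A B) : arr A -> arr B := (val f).2.

Lemma marr_src A B (f : qmor A B) a : src (marr f a) = mvert f (src a).
Proof. by have /forallP/(_ a)/andP[/eqP] := valP f. Qed.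

Lemma marr_tgt A B (f : qmor A B) a : tgt (marr f a) = mvert f (tgt a).
Proof. by have /forallP/(_ a)/andP[_ /eqP] := valP f. Qed.

Lemma qmor_of_subproof A B (fv : vert A -> vert B) (fa : arr A -> arr B) :
  (forall a, src (fa a) = fv (src a)) -> (forall a, tgt (fa a) = fv (tgt a)) ->
  is_qmor (finfun fv, finfun fa).
Proof. by move=> hs ht; apply/forallP => a /=; rewrite !ffunE hs ht !eqxx. Qed.

Definition qmor_of A B (fv : vert A -> vert B) (fa : arr A -> arr B)
    (hs : forall a, src (fa a) = fv (src a))
    (ht : forall a, tgt (fa a) = fv (tgt a)) : qmor A B :=
  exist (@is_qmor A B) _ (qmor_of_subproof hs ht).

Lemma mvertE A B fv fa hs ht v : mvert (@qmor_of A B fv fa hs ht) v = fv v.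
Proof. by rewrite /mvert /= ffunE. Qed.

Lemma marrE A B fv fa hs ht a : marr (@qmor_of A B fv fa hs ht) a = fa a.
Proof. by rewrite /marr /= ffunE. Qed.

Definition qid (A : quiver) : qmor A A :=
  qmor_of (fv := id) (fa := id) (fun=> erefl) (fun=> erefl).

Lemma qcomp_src A B C (g : qmor B C) (f : qmor A B) a :
  src (marr g (marr f a)) = mvert g (mvert f (src a)).
Proof. by rewrite !marr_src. Qed.

Lemma qcomp_tgt A B C (g : qmor B C) (f : qmor A B) a :
  tgt (marr g (marr f a)) = mvert g (mvert f (tgt a)).
Proof. by rewrite !marr_tgt. Qed.

Definition qcomp A B C (g : qmor B C) (f : qmor A B) : qmor A C :=
  qmor_of (fv := mvert g \o mvert f) (fa := marr g \o marr f)
    (qcomp_src g f) (qcomp_tgt g f).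

Lemma qmorP A B (f g : qmor A B) :
  mvert f =1 mvert g -> marr f =1 marr g -> f = g.
Proof.
move=> hv ha; apply: val_inj; case: f g hv ha => [[f1 f2] /= ?] [[g1 g2] /= ?].
by rewrite /mvert /marr /= => hv ha; congr pair; apply/ffunP.
Qed.

Lemma qcomp_id A B (f : qmor A B) : qcomp f (qid A) = f.
Proof. by apply: qmorP => u; rewrite ?(mvertE, marrE) /= ?(mvertE, marrE). Qed.

Lemma qcompA A B C D (h : qmor C D) (g : qmor B C) (f : qmor A B) :
  qcomp h (qcomp g f) = qcomp (qcomp h g) f.
Proof. by apply: qmorP => u; rewrite ?(mvertE, marrE) /= ?(mvertE, marrE). Qed.

Definition wrapping (A B : quiver) (f : qmor A B) : Prop :=
  forall (i j : vert A) (a b : arr A),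
    src a = i -> tgt a = j -> src b = i -> tgt b = j ->
    marr f a = marr f b -> a = b.

End QuiverMorphisms.

(******************************************************************************)
(* The category of quivers over Q                                             *)
(******************************************************************************)

Record qover (Q : quiver) := QOver { odom : quiver; str : qmor odom Q }.

Section QuiversOver.
Variable Q : quiver.
Implicit Types X Y Z : qover Q.

Definition ohom X Y := {f : qmor (odom X) (odom Y) | qcomp (str Y) f == str X}.

Lemma oid_subproof X : qcomp (str X) (qid (odom X)) == str X.
Proof. by rewrite qcomp_id. Qed.

Definition oid X : ohom X X := exist _ (qid (odom X)) (oid_subproof X).

Lemma ocomp_subproof X Y Z (g : ohom Y Z) (f : ohom X Y) :
  qcomp (str Z) (qcomp (val g) (val f)) == str X.
Proof. by rewrite qcompA (eqP (valP g)) (eqP (valP f)). Qed.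

Definition ocomp X Y Z (g : ohom Y Z) (f : ohom X Y) : ohom X Z :=
  exist _ (qcomp (val g) (val f)) (ocomp_subproof g f).

Definition invertible X Y (f : ohom X Y) : Prop :=
  exists g : ohom Y X, ocomp g f = oid X /\ ocomp f g = oid Y.

Definition oiso X Y : Prop := exists f : ohom X Y, invertible f.

Definition over_self : qover Q := QOver (qid Q).

Section FiberProduct.
Variables X Y : qover Q.

Definition fp_vert :=
  {p : vert (odom X) * vert (odom Y) | mvert (str X) p.1 == mvert (str Y) p.2}.
Definition fp_arr :=
  {p : arr (odom X) * arr (odom Y) | marr (str X) p.1 == marr (str Y) p.2}.

Lemma fp_src_subproof (p : fp_arr) :
  mvert (str X) (src (val p).1) == mvert (str Y) (src (val p).2).
Proof. by rewrite -!marr_src (eqP (valP p)). Qed.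

Lemma fp_tgt_subproof (p : fp_arr) :
  mvert (str X) (tgt (val p).1) == mvert (str Y) (tgt (val p).2).
Proof. by rewrite -!marr_tgt (eqP (valP p)). Qed.

Definition fp_src (p : fp_arr) : fp_vert :=
  exist (fun q => mvert (str X) q.1 == mvert (str Y) q.2)
    (src (val p).1, src (val p).2) (fp_src_subproof p).
Definition fp_tgt (p : fp_arr) : fp_vert :=
  exist (fun q => mvert (str X) q.1 == mvert (str Y) q.2)
    (tgt (val p).1, tgt (val p).2) (fp_tgt_subproof p).

Definition fp_quiver : quiver := Quiver fp_src fp_tgt.

Lemma fp_str_src (p : arr fp_quiver) :
  src (marr (str X) (val p).1) = mvert (str X) (val (src p)).1.
Proof. exact: marr_src. Qed.

Lemma fp_str_tgt (p : arr fp_quiver) :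
  tgt (marr (str X) (val p).1) = mvert (str X) (val (tgt p)).1.
Proof. exact: marr_tgt. Qed.

Definition fiber_product : qover Q :=
  QOver (qmor_of (A := fp_quiver) (fv := fun p => mvert (str X) (val p).1)
    (fa := fun p => marr (str X) (val p).1) fp_str_src fp_str_tgt).

End FiberProduct.

Section DisjointUnion.
Variables (I : finType) (F : I -> qover Q).

Definition du_quiver : quiver :=
  @Quiver {i : I & vert (odom (F i))} {i : I & arr (odom (F i))}
    (fun a => Tagged (fun i => vert (odom (F i))) (src (tagged a)))
    (fun a => Tagged (fun i => vert (odom (F i))) (tgt (tagged a))).

Lemma du_str_src (p : arr du_quiver) :
  src (marr (str (F (tag p))) (tagged p))
  = mvert (str (F (tag (src p)))) (tagged (src p)).
Proof. exact: marr_src. Qed.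

Lemma du_str_tgt (p : arr du_quiver) :
  tgt (marr (str (F (tag p))) (tagged p))
  = mvert (str (F (tag (tgt p)))) (tagged (tgt p)).
Proof. exact: marr_tgt. Qed.

Definition disjoint_union : qover Q :=
  QOver (qmor_of (A := du_quiver)
    (fv := fun p => mvert (str (F (tag p))) (tagged p))
    (fa := fun p => marr (str (F (tag p))) (tagged p)) du_str_src du_str_tgt).

End DisjointUnion.
End QuiversOver.

(* A finite full subcategory of the category of quivers over Q is given by a
   finite type C0 indexing its objects, and a family ob : C0 -> qover Q; the
   morphisms x -> y are all the morphisms ob x -> ob y over Q.  Distinct indices
   stand for distinct objects: [acyclic] forces ob to be injective. *)
Section FullSubcategory.
Variables (Q : quiver) (C0 : finType) (ob : C0 -> qover Q).

Definition acyclic : Prop :=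
  (forall (x : C0) (f : ohom (ob x) (ob x)), f = oid (ob x)) /\
  (forall (x y : C0) (f : ohom (ob x) (ob y)), invertible f ->
     exists e : x = y, f = ecast z (ohom (ob x) (ob z)) e (oid (ob x))).

(* I may be empty. *)
Definition closed_under_fiber_products : Prop :=
  forall x y : C0, exists (I : finType) (g : I -> C0),
    oiso (fiber_product (ob x) (ob y)) (disjoint_union (fun i => ob (g i))).

Definition hom_mx : 'M[int]_#|C0| :=
  \matrix_(i, j) #|{: ohom (ob (enum_val i)) (ob (enum_val j))}|%:Z.

(* hom_mx is invertible over the integers as soon as [acyclic] holds. *)
Definition mobius (x y : C0) : int :=
  invmx hom_mx (enum_rank x) (enum_rank y).

Definition delta (x : C0) : {freeg C0 / int} :=
  \sum_(z : C0) << mobius z x *g z >>.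

End FullSubcategory.

(******************************************************************************)
(* Representations                                                            *)
(******************************************************************************)

(* Finite dimensional representations are written in coordinates: the space at x
   is the space of row vectors 'rV[K]_(rdim x), and the map over an arrow a is
   v |-> v *m rmap a.  Choosing bases, every finite dimensional representation
   is isomorphic to one of this form. *)
Record rep (K : fieldType) (Q : quiver) := Rep {
  rdim : vert Q -> nat;
  rmap : forall a : arr Q, 'M[K]_(rdim (src a), rdim (tgt a)) }.

Section Representations.
Variables (K : fieldType) (Q : quiver).
Implicit Types U V W : rep K Q.

Definition is_rep_hom V W (g : forall x, 'M[K]_(rdim V x, rdim W x)) : Prop :=
  forall a : arr Q, rmap V a *m g (tgt a) = g (src a) *m rmap W a.

Definition rep_iso V W : Prop :=
  exists (g : forall x, 'M[K]_(rdim V x, rdim W x))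
         (h : forall x, 'M[K]_(rdim W x, rdim V x)),
    [/\ is_rep_hom g, is_rep_hom h,
        forall x, g x *m h x = 1%:M & forall x, h x *m g x = 1%:M].

Definition rep_sum V W : rep K Q :=
  @Rep K Q (fun x => rdim V x + rdim W x)%N
    (fun a => block_mx (rmap V a) 0 0 (rmap W a)).

Definition rep_tensor V W : rep K Q :=
  @Rep K Q (fun x => rdim V x * rdim W x)%N (fun a => rmap V a *t rmap W a).

Definition rep_unit : rep K Q := @Rep K Q (fun=> 1%N) (fun=> 1%:M).

Definition rep_is_zero V : Prop := forall x, rdim V x = 0%N.

Definition indecomposable V : Prop :=
  ~ rep_is_zero V /\
  forall U W, rep_iso V (rep_sum U W) -> rep_is_zero U \/ rep_is_zero W.

Section Linearization.
Variable X : qover Q.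

Definition fiber (x : vert Q) := {v : vert (odom X) | mvert (str X) v == x}.

(* The basis vector b_v is indexed by the rank of v in the fiber. *)
Definition lin_arrow (b : arr (odom X)) (x y : vert Q) :
    'M[K]_(#|{: fiber x}|, #|{: fiber y}|) :=
  \matrix_(i, j) ((val (enum_val i) == src b) && (val (enum_val j) == tgt b))%:R.

Definition linearization : rep K Q :=
  @Rep K Q (fun x => #|{: fiber x}|)
    (fun a => \sum_(b | marr (str X) b == a) lin_arrow b (src a) (tgt a)).

End Linearization.

Lemma rep_iso_refl V : rep_iso V V.
Proof.
exists (fun=> 1%:M), (fun=> 1%:M).
by split=> [a|a|x|x]; rewrite ?mul1mx ?mulmx1.
Qed.

Lemma rep_iso_sym V W : rep_iso V W -> rep_iso W V.
Proof. by case=> g [h [? ? ? ?]]; exists h, g. Qed.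

Lemma rep_iso_trans V W U : rep_iso V W -> rep_iso W U -> rep_iso V U.
Proof.
case=> g [h [hg hh gh hgK]] [g' [h' [hg' hh' gh' hgK']]].
exists (fun x => g x *m g' x), (fun x => h' x *m h x); split=> [a|a|x|x].
- by rewrite mulmxA hg -mulmxA hg' mulmxA.
- by rewrite mulmxA hh' -mulmxA hh mulmxA.
- by rewrite -mulmxA (mulmxA (g' x)) gh' mul1mx.
- by rewrite -mulmxA (mulmxA (h x)) hgK mul1mx.
Qed.

Lemma rep_iso_reindex V W
    (s : forall x, 'I_(rdim V x) -> 'I_(rdim W x))
    (t : forall x, 'I_(rdim W x) -> 'I_(rdim V x)) :
  (forall x, cancel (s x) (t x)) -> (forall x, cancel (t x) (s x)) ->
  (forall a i j, rmap V a i j = rmap W a (s _ i) (s _ j)) -> rep_iso V W.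
Proof.
move=> sK tK E.
have mulr_ind p q (A : 'M[K]_(p, q)) x (f : 'I_x -> 'I_q) (f' : 'I_q -> 'I_x) :
    cancel f' f -> cancel f f' ->
    A *m (\matrix_(i, j) (f' i == j)%:R) = \matrix_(i, j) A i (f j).
  move=> fK fK'; apply/matrixP => i k; rewrite !mxE (bigD1 (f k)) //= big1.
    by rewrite !mxE fK' eqxx mulr1 addr0.
  move=> j nj; rewrite !mxE; case: eqP => [e|_]; last by rewrite mulr0.
  by rewrite -e fK eqxx in nj.
have mull_ind p q (A : 'M[K]_(p, q)) x (f : 'I_x -> 'I_p) :
    (\matrix_(i, j) (f i == j)%:R) *m A = \matrix_(i, j) A (f i) j.
  apply/matrixP => i k; rewrite !mxE (bigD1 (f i)) //= big1.
    by rewrite !mxE eqxx mul1r addr0.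
  by move=> j nj; rewrite !mxE eq_sym (negPf nj) mul0r.
exists (fun x => \matrix_(i, j) (s x i == j)%:R),
       (fun x => \matrix_(i, j) (t x i == j)%:R); split=> [a|a|x|x].
- rewrite (mulr_ind _ _ _ _ (t _)) // mull_ind.
  by apply/matrixP => i j; rewrite !mxE E tK.
- rewrite (mulr_ind _ _ _ _ (s _)) // mull_ind.
  by apply/matrixP => i j; rewrite !mxE E tK.
- by rewrite mull_ind; apply/matrixP => i j; rewrite !mxE sK.
- by rewrite mull_ind; apply/matrixP => i j; rewrite !mxE tK.
Qed.

Lemma rep_tensor_iso V V' W W' :
  rep_iso V V' -> rep_iso W W' -> rep_iso (rep_tensor V W) (rep_tensor V' W').
Proof.
have tens1 m n : (1%:M : 'M[K]_m) *t (1%:M : 'M[K]_n) = 1%:M.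
  apply/matrixP => i j; case: (mxtens_indexP i) (mxtens_indexP j).
  move=> i1 i2 [j1 j2]; rewrite tensmxE !mxE -natrM mulnb.
  by rewrite (can_eq (@mxtens_indexK _ _)).
case=> g [h [hg hh gh hgK]] [g' [h' [hg' hh' gh' hgK']]].
exists (fun x => g x *t g' x), (fun x => h x *t h' x).
split=> [a|a|x|x] /=; rewrite !tensmx_mul.
- by rewrite hg hg'.
- by rewrite hh hh'.
- by rewrite gh gh' tens1.
- by rewrite hgK hgK' tens1.
Qed.

Lemma rep_tensorC V W : rep_iso (rep_tensor V W) (rep_tensor W V).
Proof.
pose sw m n (k : 'I_(m * n)) : 'I_(n * m) :=
  mxtens_index ((mxtens_unindex k).2, (mxtens_unindex k).1).
have swK m n : cancel (@sw m n) (@sw n m).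
  by move=> k; case: (mxtens_indexP k) => i j; rewrite /sw !mxtens_indexK.
apply: (@rep_iso_reindex (rep_tensor V W) (rep_tensor W V)
  (fun x => @sw _ _) (fun x => @sw _ _)) => //= a i j.
case: (mxtens_indexP i) (mxtens_indexP j) => i1 i2 [j1 j2].
by rewrite /sw !mxtens_indexK !tensmxE mulrC.
Qed.

Lemma rep_tensorA V W U :
  rep_iso (rep_tensor V (rep_tensor W U)) (rep_tensor (rep_tensor V W) U).
Proof.
pose s m n p (k : 'I_(m * (n * p))) : 'I_(m * n * p) :=
  let i := mxtens_unindex k in let j := mxtens_unindex i.2 in
  mxtens_index (mxtens_index (i.1, j.1), j.2).
pose t m n p (k : 'I_(m * n * p)) : 'I_(m * (n * p)) :=
  let i := mxtens_unindex k in let j := mxtens_unindex i.1 in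
  mxtens_index (j.1, mxtens_index (j.2, i.2)).
apply: (@rep_iso_reindex (rep_tensor V (rep_tensor W U))
  (rep_tensor (rep_tensor V W) U) (fun x => @s _ _ _) (fun x => @t _ _ _))
  => //= [x k|x k|a i j].
- case: (mxtens_indexP k) => i j; case: (mxtens_indexP j) => j1 j2.
  by rewrite /s /t !mxtens_indexK.
- case: (mxtens_indexP k) => i j; case: (mxtens_indexP i) => i1 i2.
  by rewrite /s /t !mxtens_indexK.
- case: (mxtens_indexP i) (mxtens_indexP j) => i1 i2 [j1 j2].
  case: (mxtens_indexP i2) (mxtens_indexP j2) => i3 i4 [j3 j4].
  by rewrite /s !mxtens_indexK !tensmxE mulrA.
Qed.

Lemma rep_tensor1 V : rep_iso (rep_tensor rep_unit V) V.
Proof.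
pose s n (k : 'I_(1 * n)) : 'I_n := (mxtens_unindex k).2.
pose t n (i : 'I_n) : 'I_(1 * n) := mxtens_index (ord0, i).
have tsE n i j : @s n (mxtens_index (i, j)) = j by rewrite /s mxtens_indexK.
apply: (@rep_iso_reindex (rep_tensor rep_unit V) V
  (fun x => @s _) (fun x => @t _)) => //= [x k|x k|a i j].
- by case: (mxtens_indexP k) => i j; rewrite tsE /t (ord1 i).
- by rewrite tsE.
- case: (mxtens_indexP i) (mxtens_indexP j) => i1 i2 [j1 j2].
  by rewrite !tsE !tensmxE !mxE !ord1 eqxx mul1r.
Qed.

Lemma rep_tensorDl V W U :
  rep_iso (rep_tensor (rep_sum V W) U)
          (rep_sum (rep_tensor V U) (rep_tensor W U)).
Proof.
pose s m n p (k : 'I_((m + n) * p)) : 'I_(m * p + n * p) :=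
  let i := mxtens_unindex k in
  match split i.1 with
  | inl i1 => lshift _ (mxtens_index (i1, i.2))
  | inr i1 => rshift _ (mxtens_index (i1, i.2))
  end.
pose t m n p (k : 'I_(m * p + n * p)) : 'I_((m + n) * p) :=
  match split k with
  | inl i => mxtens_index (lshift _ (mxtens_unindex i).1, (mxtens_unindex i).2)
  | inr i => mxtens_index (rshift _ (mxtens_unindex i).1, (mxtens_unindex i).2)
  end.
have splitl m n (i : 'I_m) : split (lshift n i) = inl i.
  exact: (unsplitK (inl _ i)).
have splitr m n (i : 'I_n) : split (rshift m i) = inr i.
  exact: (unsplitK (inr _ i)).
have sl m n p i j :
    @s m n p (mxtens_index (lshift n i, j)) = lshift _ (mxtens_index (i, j)).
  by rewrite /s mxtens_indexK [(_, _).1]/(lshift n i) splitl.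
have sr m n p i j :
    @s m n p (mxtens_index (rshift m i, j)) = rshift _ (mxtens_index (i, j)).
  by rewrite /s mxtens_indexK [(_, _).1]/(rshift m i) splitr.
have tl m n p i j :
    @t m n p (lshift _ (mxtens_index (i, j))) = mxtens_index (lshift n i, j).
  by rewrite /t splitl mxtens_indexK.
have tr m n p i j :
    @t m n p (rshift _ (mxtens_index (i, j))) = mxtens_index (rshift m i, j).
  by rewrite /t splitr mxtens_indexK.
apply: (@rep_iso_reindex (rep_tensor (rep_sum V W) U)
  (rep_sum (rep_tensor V U) (rep_tensor W U))
  (fun x => @s _ _ _) (fun x => @t _ _ _)) => //= [x k|x k|a i j].
- case: (mxtens_indexP k) => i j.
  by case: (split_ordP i) => i' ->; rewrite ?sl ?sr ?tl ?tr.
- case: (split_ordP k) => i ->; case: (mxtens_indexP i) => i1 i2.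
    by rewrite tl sl.
  by rewrite tr sr.
- case: (mxtens_indexP i) (mxtens_indexP j) => i1 i2 [j1 j2].
  rewrite tensmxE.
  case: (split_ordP i1) (split_ordP j1) => [i' ->|i' ->] [j' ->|j' ->];
  by rewrite ?sl ?sr ?block_mxEul ?block_mxEur ?block_mxEdl ?block_mxEdr
             ?tensmxE ?mxE ?mul0r.
Qed.

End Representations.

(******************************************************************************)
(* Free abelian groups                                                        *)
(******************************************************************************)

Section Zlift.
Variables (T : choiceType) (M : zmodType).

(* The additive extension of f to the free abelian group on T; zmodule M is M viewed
   as a module over the integers. *)
Definition zlift (f : T -> M) : {freeg T / int} -> M :=
  fglift (f : T -> (zmodule M)).

Lemma zlift_is_zmod_morphism f : zmod_morphism (zlift f).
Proof. exact: (@lift_is_additive int T (zmodule M)). Qed.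

HB.instance Definition _ f :=
  GRing.isZmodMorphism.Build {freeg T / int} M (zlift f)
    (zlift_is_zmod_morphism f).

Lemma zliftU f x : zlift f << x >> = f x.
Proof. by rewrite /zlift liftU scale1r. Qed.

Lemma freegZ k x : << k *g x >> = << x >> *~ k :> {freeg T / int}.
Proof. by rewrite freegU_mulz intz. Qed.

Lemma zlift_eq (f g : {freeg T / int} -> M) :
  zmod_morphism f -> zmod_morphism g ->
  (forall x, f << x >> = g << x >>) -> f =1 g.
Proof.
move=> fB gB E D.
pose fA := GRing.isZmodMorphism.Build _ _ f fB.
pose gA := GRing.isZmodMorphism.Build _ _ g gB.
pose F : {additive {freeg T / int} -> M} := HB.pack f fA.
pose G : {additive {freeg T / int} -> M} := HB.pack g gA.
rewrite -[f]/(F : _ -> _) -[g]/(G : _ -> _).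
rewrite -[D]freeg_sumE !raddf_sum; apply: eq_bigr => x _.
by rewrite freegZ !raddfMz; congr (_ *~ _); exact: E.
Qed.

Lemma zliftB (f g : T -> M) D :
  zlift (fun x => f x - g x) D = zlift f D - zlift g D.
Proof.
apply: (@zlift_eq _ (fun D => zlift f D - zlift g D)) => [|a b|x].
- exact: zlift_is_zmod_morphism.
- by rewrite /= (raddfB (zlift f)) (raddfB (zlift g)) !opprD addrACA.
- by rewrite !zliftU.
Qed.

End Zlift.

(******************************************************************************)
(* The representation ring                                                    *)
(******************************************************************************)

HB.instance Definition _ (K : fieldType) (Q : quiver) := gen_eqMixin (rep K Q).
HB.instance Definition _ (K : fieldType) (Q : quiver) :=
  gen_choiceMixin (rep K Q).

Section RepresentationRing.
Variables (K : fieldType) (Q : quiver).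

Definition rep_isob (V W : rep K Q) : bool := `[< rep_iso V W >].

Lemma rep_isob_equiv : equiv_class_of rep_isob.
Proof.
split=> [V|V W|W V U].
- by apply/asboolP; exact: rep_iso_refl.
- by apply/asboolP/asboolP; exact: rep_iso_sym.
- by move=> /asboolP h1 /asboolP h2; apply/asboolP; exact: rep_iso_trans h1 h2.
Qed.

Canonical rep_isob_equivrel := EquivRelPack rep_isob_equiv.

Definition isoclass := {eq_quot rep_isob}.
HB.instance Definition _ := Choice.on isoclass.
HB.instance Definition _ := EqQuotient.on isoclass.

Definition icls (V : rep K Q) : isoclass := \pi_isoclass V.

Lemma iclsP V W : (icls V = icls W) <-> rep_iso V W.
Proof.
split=> [/eqP|h]; last by apply/eqP; rewrite piE; apply/asboolP.
by rewrite piE => /asboolP.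
Qed.

Definition free_rep := {freeg isoclass / int}.

Definition sum_relations : set free_rep :=
  [set r | exists V W : rep K Q,
     r = << icls (rep_sum V W) >> - << icls V >> - << icls W >>].

Definition is_subgroup (M : zmodType) (A : set M) : Prop :=
  A 0 /\ forall x y, A x -> A y -> A (x - y).

Definition sum_subgroup : {pred free_rep} :=
  fun r => `[< smallest (@is_subgroup free_rep) sum_relations r >].

Lemma sum_subgroup_closed : zmod_closed sum_subgroup.
Proof.
split=> [|x y /asboolP hx /asboolP hy].
  by apply/asboolP => A [[]].
apply/asboolP => A [hA sA]; apply: hA.2; [exact: hx|exact: hy].
Qed.

HB.instance Definition _ :=
  GRing.isZmodClosed.Build free_rep sum_subgroup sum_subgroup_closed.

Definition rep_ring := Quotient.quot sum_subgroup.
HB.instance Definition _ := GRing.Zmodule.on rep_ring.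

Definition cls_tensor (x y : isoclass) : isoclass :=
  icls (rep_tensor (repr x) (repr y)).

Lemma repr_icls V : rep_iso (repr (icls V)) V.
Proof. by apply/iclsP; rewrite /icls reprK. Qed.

Lemma cls_tensorE V W :
  cls_tensor (icls V) (icls W) = icls (rep_tensor V W).
Proof. by apply/iclsP/rep_tensor_iso; exact: repr_icls. Qed.

Lemma iclsW (P : isoclass -> Prop) : (forall V, P (icls V)) -> forall x, P x.
Proof. by move=> PV x; rewrite -[x]reprK; exact: PV. Qed.

Lemma cls_tensorC : commutative cls_tensor.
Proof.
elim/iclsW => V; elim/iclsW => W; rewrite !cls_tensorE.
by apply/iclsP; exact: rep_tensorC.
Qed.

Lemma cls_tensorA : associative cls_tensor.
Proof.
elim/iclsW => V; elim/iclsW => W; elim/iclsW => U; rewrite !cls_tensorE.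
by apply/iclsP; exact: rep_tensorA.
Qed.

Lemma cls_tensor1 : left_id (icls (rep_unit K Q)) cls_tensor.
Proof.
by elim/iclsW => V; rewrite cls_tensorE; apply/iclsP; exact: rep_tensor1.
Qed.

Definition free_mul (x y : free_rep) : free_rep :=
  zlift (fun u => zlift (fun v => << cls_tensor u v >>) y) x.

Definition free_one : free_rep := << icls (rep_unit K Q) >>.

Lemma free_mulU u v : free_mul << u >> << v >> = << cls_tensor u v >>.
Proof. by rewrite /free_mul !zliftU. Qed.

Lemma free_mulBl x y z : free_mul (x - y) z = free_mul x z - free_mul y z.
Proof. exact: raddfB. Qed.

Lemma free_mulBr x y z : free_mul x (y - z) = free_mul x y - free_mul x z.
Proof.
rewrite /free_mul -zliftB; congr (zlift _ x); apply/funext => u.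
exact: raddfB.
Qed.

Lemma free_mulDl x y z : free_mul (x + y) z = free_mul x z + free_mul y z.
Proof. exact: raddfD. Qed.

Lemma free_mulC : commutative free_mul.
Proof.
move=> x y; move: x; apply: zlift_eq => [a b|a b|u].
- exact: free_mulBl.
- exact: free_mulBr.
move: y; apply: zlift_eq => [a b|a b|v].
- exact: free_mulBr.
- exact: free_mulBl.
by rewrite !free_mulU cls_tensorC.
Qed.

Lemma free_mulA : associative free_mul.
Proof.
move=> x y z; move: x; apply: zlift_eq => [a b|a b|u].
- exact: free_mulBl.
- by rewrite !free_mulBl.
move: y; apply: zlift_eq => [a b|a b|v].
- by rewrite free_mulBl free_mulBr.
- by rewrite free_mulBr free_mulBl.
move: z; apply: zlift_eq => [a b|a b|w].
- by rewrite !free_mulBr.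
- exact: free_mulBr.
by rewrite !free_mulU cls_tensorA.
Qed.

Lemma free_mul1 : left_id free_one free_mul.
Proof.
apply: zlift_eq => [a b|//|u]; first exact: free_mulBr.
by rewrite free_mulU cls_tensor1.
Qed.

Lemma sum_subgroup_mulr x y :
  x \in sum_subgroup -> free_mul x y \in sum_subgroup.
Proof.
move=> /asboolP hx; apply/asboolP.
apply: (hx (fun x => smallest (@is_subgroup free_rep) sum_relations
  (free_mul x y))) => {x hx}; split=> [|r [V [W ->]]].
  split=> [|a b ha hb]; last first.
    by rewrite free_mulBl => A hA; apply: (hA.1).2; [exact: ha|exact: hb].
  by rewrite -(subrr 0) free_mulBl subrr => A [[]].
pose P z := smallest (@is_subgroup free_rep) sum_relations
  (free_mul (<< icls (rep_sum V W) >> - << icls V >> - << icls W >>) z).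
have P0 : P 0 by rewrite /P -(subrr 0) free_mulBr subrr => A [[]].
have PB a b : P a -> P b -> P (a - b).
  by rewrite /P free_mulBr => ha hb A hA; apply: (hA.1).2; [exact: ha|exact: hb].
have PN a : P a -> P (- a) by rewrite -sub0r; exact: PB.
have PD a b : P a -> P b -> P (a + b).
  by move=> ha hb; rewrite -[b]opprK; apply: PB => //; exact: PN.
have PMn a n : P a -> P (a *+ n).
  by move=> ha; elim: n => // n IH; rewrite mulrS; exact: PD.
have PU u : P << u >>.
  move: u; elim/iclsW => U A [_]; apply.
  exists (rep_tensor V U), (rep_tensor W U).
  rewrite !free_mulBl !free_mulU !cls_tensorE.
  by congr (<< _ >> - _ - _); apply/iclsP; exact: rep_tensorDl.
rewrite -/(P y) -[y]freeg_sumE; apply: (big_ind P) => // u _.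
rewrite freegZ; case: (coeff u y) => n; first exact: PMn (PU u).
by rewrite NegzE mulrNz; apply: PN; exact: PMn (PU u).
Qed.

Definition rep_ring_one : rep_ring := \pi_rep_ring free_one.
Definition rep_ring_mul := lift_op2 rep_ring free_mul.

Lemma pi_rep_ring_mul :
  {morph \pi_rep_ring : x y / free_mul x y >-> rep_ring_mul x y}.
Proof.
move=> x y; unlock rep_ring_mul; apply/eqP.
have reprB z : z - repr (\pi_rep_ring z) \in sum_subgroup.
  by rewrite Quotient.idealrBE reprK.
rewrite -Quotient.idealrBE.
rewrite -[X in X - _](subrK (free_mul (repr (\pi_rep_ring x)) y)).
rewrite -free_mulBl -addrA -free_mulBr; apply: rpredD.
  exact: sum_subgroup_mulr.
by rewrite free_mulC; exact: sum_subgroup_mulr.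
Qed.

Lemma rep_ringW (P : rep_ring -> Prop) :
  (forall x, P (\pi_rep_ring x)) -> forall x, P x.
Proof. by move=> Px x; rewrite -[x]reprK; exact: Px. Qed.

Lemma rep_ring_mulA : associative rep_ring_mul.
Proof.
elim/rep_ringW => x; elim/rep_ringW => y; elim/rep_ringW => z.
by rewrite -!pi_rep_ring_mul free_mulA.
Qed.

Lemma rep_ring_mulC : commutative rep_ring_mul.
Proof.
elim/rep_ringW => x; elim/rep_ringW => y.
by rewrite -!pi_rep_ring_mul free_mulC.
Qed.

Lemma rep_ring_mul1 : left_id rep_ring_one rep_ring_mul.
Proof. by elim/rep_ringW => x; rewrite -pi_rep_ring_mul free_mul1. Qed.

Lemma rep_ring_mulDl : left_distributive rep_ring_mul +%R.
Proof.
elim/rep_ringW => x; elim/rep_ringW => y; elim/rep_ringW => z.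
by rewrite -raddfD -!pi_rep_ring_mul -raddfD free_mulDl.
Qed.

(* Only a comPzRingType: rep_ring is the zero ring when Q is empty. *)
HB.instance Definition _ := GRing.Zmodule_isComPzRing.Build rep_ring
  rep_ring_mulA rep_ring_mulC rep_ring_mul1 rep_ring_mulDl.

Definition rep_class (V : rep K Q) : rep_ring := \pi_rep_ring << icls V >>.

Lemma rep_class_iso V W : rep_iso V W -> rep_class V = rep_class W.
Proof. by move=> /iclsP h; rewrite /rep_class h. Qed.

Lemma rep_class_sum V W : rep_class (rep_sum V W) = rep_class V + rep_class W.
Proof.
rewrite /rep_class -raddfD; apply/eqP.
rewrite -Quotient.idealrBE opprD addrA; apply/asboolP => A [_]; apply.
by exists V, W.
Qed.

Lemma rep_class_tensor V W :
  rep_class (rep_tensor V W) = rep_class V * rep_class W.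
Proof. by rewrite -[RHS]pi_rep_ring_mul free_mulU cls_tensorE. Qed.

Lemma rep_class_unit : rep_class (rep_unit K Q) = 1.
Proof. by []. Qed.

End RepresentationRing.

(* The additive extension of L to the free abelian group on the objects. *)
Definition lin_class (K : fieldType) (Q : quiver) (C0 : finType)
    (ob : C0 -> qover Q) : {freeg C0 / int} -> rep_ring K Q :=
  zlift (fun x => rep_class (linearization K (ob x))).

(******************************************************************************)
(* Subrings, bases, ideals and products                                       *)
(******************************************************************************)

Section Rings.
Variable R : comPzRingType.

(* A subring need not contain 1. *)
Definition is_subring (A : set R) : Prop :=
  (exists x, A x) /\ forall x y, A x -> A y -> A (x - y) /\ A (x * y).

Definition subring_generated (S : set R) : set R := smallest is_subring S.

Definition orthogonal_idempotents (I : eqType) (b : I -> R) : Prop :=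
  forall i j, b i * b j = if i == j then b i else 0.

Definition Z_basis (A : set R) (I : finType) (b : I -> R) : Prop :=
  (forall i, A (b i)) /\
  forall r, A r -> exists! c : {ffun I -> int}, r = \sum_i b i *~ c i.

Definition principal_ideal (e : R) : {pred R} :=
  fun r => `[< exists s, r = s * e >].

Lemma principal_ideal_closed e : zmod_closed (principal_ideal e).
Proof.
split=> [|_ _ /asboolP[s ->] /asboolP[t ->]]; apply/asboolP.
  by exists 0; rewrite mul0r.
by exists (s - t); rewrite mulrBl.
Qed.

HB.instance Definition _ e :=
  GRing.isZmodClosed.Build R (principal_ideal e) (principal_ideal_closed e).

(* The ideal generated by an idempotent e is a ring, for the addition and the
   multiplication of R and with identity element e. *)
Section IdealRing.
Variables (e : R) (he : e * e = e).

Definition ideal_ring of e * e = e := {r : R | r \in principal_ideal e}.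
Local Notation ering := (ideal_ring he).

HB.instance Definition _ := SubChoice.on ering.
HB.instance Definition _ := [SubChoice_isSubZmodule of ering by <:].

Lemma ideal_one_subproof : e \in principal_ideal e.
Proof. by apply/asboolP; exists 1; rewrite mul1r. Qed.

Lemma ideal_mul_subproof (x y : ering) : val x * val y \in principal_ideal e.
Proof.
have /asboolP[s ->] := valP y.
by apply/asboolP; exists (val x * s); rewrite mulrA.
Qed.

Definition ideal_one : ering := exist _ e ideal_one_subproof.
Definition ideal_mul (x y : ering) : ering :=
  exist _ (val x * val y) (ideal_mul_subproof x y).

Lemma ideal_mulA : associative ideal_mul.
Proof. by move=> x y z; apply: val_inj; rewrite /= mulrA. Qed.

Lemma ideal_mulC : commutative ideal_mul.
Proof. by move=> x y; apply: val_inj; rewrite /= mulrC. Qed.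

Lemma ideal_mul1 : left_id ideal_one ideal_mul.
Proof.
move=> x; apply: val_inj => /=; have /asboolP[s ->] := valP x.
by rewrite mulrCA he.
Qed.

Lemma ideal_mulDl : left_distributive ideal_mul +%R.
Proof. by move=> x y z; apply: val_inj; rewrite /= mulrDl. Qed.

HB.instance Definition _ := GRing.Zmodule_isComPzRing.Build ering
  ideal_mulA ideal_mulC ideal_mul1 ideal_mulDl.

End IdealRing.
End Rings.

Section ProductRing.
Variables (I : Type) (S : I -> comPzRingType).

Definition prod_ring := forall i, S i.

HB.instance Definition _ := gen_eqMixin prod_ring.
HB.instance Definition _ := gen_choiceMixin prod_ring.

Definition prod_add (f g : prod_ring) : prod_ring := fun i => f i + g i.
Definition prod_opp (f : prod_ring) : prod_ring := fun i => - f i.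
Definition prod_zero : prod_ring := fun i => 0.
Definition prod_mul (f g : prod_ring) : prod_ring := fun i => f i * g i.
Definition prod_one : prod_ring := fun i => 1.

Lemma prod_addA : associative prod_add.
Proof. by move=> f g h; apply: functional_extensionality_dep => i;
  exact: addrA. Qed.
Lemma prod_addC : commutative prod_add.
Proof. by move=> f g; apply: functional_extensionality_dep => i;
  exact: addrC. Qed.
Lemma prod_add0 : left_id prod_zero prod_add.
Proof. by move=> f; apply: functional_extensionality_dep => i;
  exact: add0r. Qed.
Lemma prod_addN : left_inverse prod_zero prod_opp prod_add.
Proof. by move=> f; apply: functional_extensionality_dep => i;
  exact: addNr. Qed.
Lemma prod_mulA : associative prod_mul.
Proof. by move=> f g h; apply: functional_extensionality_dep => i;
  exact: mulrA. Qed.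
Lemma prod_mulC : commutative prod_mul.
Proof. by move=> f g; apply: functional_extensionality_dep => i;
  exact: mulrC. Qed.
Lemma prod_mul1 : left_id prod_one prod_mul.
Proof. by move=> f; apply: functional_extensionality_dep => i;
  exact: mul1r. Qed.
Lemma prod_mulDl : left_distributive prod_mul prod_add.
Proof. by move=> f g h; apply: functional_extensionality_dep => i;
  exact: mulrDl. Qed.

HB.instance Definition _ := GRing.isZmodule.Build prod_ring
  prod_addA prod_addC prod_add0 prod_addN.
HB.instance Definition _ := GRing.Zmodule_isComPzRing.Build prod_ring
  prod_mulA prod_mulC prod_mul1 prod_mulDl.

End ProductRing.

(* Main.v *)
Require Import Defs.
From HB Require Import structures.
From mathcomp Require Import all_boot all_order all_algebra.
From mathcomp Require Import fingroup perm.
From mathcomp Require Import generic_quotient ring_quotient.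
From mathcomp Require Import boolp classical_sets.
From mathcomp Require Import mxtens.
From mathcomp Require Import freeg.

(* Linearization turns fiber products into tensor products and disjoint unions
   into sums, so L(x) L(y) is the sum of the L(z) over the components z of the
   fiber product of x and y.  For connected w, the number [w, x] of morphisms is
   multiplicative on fiber products and additive on disjoint unions; hence
   expanding L(x) = sum_w [w, x] L(delta_w) by Moebius inversion gives
   L(x) L(y) = sum_w [w, x] [w, y] L(delta_w), which makes the L(delta_w)
   orthogonal idempotents.  When (Q, id) is in the category it is terminal, and
   1 = L(Q, id) is the sum of all L(delta_w).

   Linear independence needs a form of the Krull-Schmidt theorem.  For M
   indecomposable, V |-> dim Hom(M, V) - dim rad(M, V) is additive in V, because
   End(M) is local and so rad(M, -) is a subfunctor of Hom(M, -).  It is nonzero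
   at M and vanishes at the other indecomposables, so it is a functional on the
   representation ring isolating the coefficient of [M]. *)

Set Implicit Arguments.
Unset Strict Implicit.
Unset Printing Implicit Defensive.

Import GRing.Theory.
Local Open Scope ring_scope.

(** * Endomorphisms of indecomposable representations *)

Section HornerMatrix.
Variable K : fieldType.

(* [horner_mx] is only available for matrices of nonzero size. *)
Definition mxhorner n : 'M[K]_n -> {poly K} -> 'M[K]_n :=
  if n is n'.+1 then @horner_mx K n' else fun _ _ => 0.

Lemma mxhornerD n (A : 'M[K]_n) p q :
  mxhorner A (p + q) = mxhorner A p + mxhorner A q.
Proof. by case: n A => [|n] A; [rewrite [RHS]flatmx0 flatmx0|exact: rmorphD]. Qed.

Lemma mxhornerM n (A : 'M[K]_n) p q :
  mxhorner A (p * q) = mxhorner A p *m mxhorner A q.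
Proof. by case: n A => [|n] A; [rewrite [RHS]flatmx0 flatmx0|exact: rmorphM]. Qed.

Lemma mxhornerC n (A : 'M[K]_n) c : mxhorner A c%:P = c%:M.
Proof.
by case: n A => [|n] A; [rewrite [RHS]flatmx0 flatmx0|exact: horner_mx_C].
Qed.

Lemma mxhorner1 n (A : 'M[K]_n) : mxhorner A 1 = 1%:M.
Proof. exact: mxhornerC. Qed.

Lemma mxhornerX n (A : 'M[K]_n) : mxhorner A 'X = A.
Proof. by case: n A => [|n] A; [rewrite [RHS]flatmx0 flatmx0|exact: horner_mx_X].
Qed.

Lemma mxhorner_dvd n (A : 'M[K]_n) p q :
  p %| q -> mxhorner A p = 0 -> mxhorner A q = 0.
Proof. by move=> /dvdpP[r ->] pA; rewrite mxhornerM pA mulmx0. Qed.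

Lemma mxhorner_char_poly n (A : 'M[K]_n) : mxhorner A (char_poly A) = 0.
Proof.
by case: n A => [|n] A; [rewrite flatmx0|exact: Cayley_Hamilton].
Qed.

(** With [g] the map over an arrow, this makes every polynomial in an endomorphism of a
    representation an endomorphism again. *)
Lemma mxhorner_intertwine m n (A : 'M[K]_m) (B : 'M[K]_n) (g : 'M_(m, n)) p :
  g *m B = A *m g -> g *m mxhorner B p = mxhorner A p *m g.
Proof.
move=> gBA; elim/poly_ind: p => [|p c IH].
  by rewrite -[0]/(0%:P) !mxhornerC mul_mx_scalar mul_scalar_mx.
rewrite !mxhornerD !mxhornerM !mxhornerC !mxhornerX mulmxDr mulmxDl.
by rewrite mulmxA IH -mulmxA gBA mulmxA mul_mx_scalar mul_scalar_mx.
Qed.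

(** Evaluating a Bezout relation [u p + v q = 1] at [A] leaves [v(A) q(A) = 1]. *)
Lemma mxhorner_unit n (A : 'M[K]_n) p q :
  coprimep p q -> mxhorner A p = 0 -> mxhorner A q \in unitmx.
Proof.
move=> /Bezout_eq1_coprimepP[[u v] /= uv] pA.
have := congr1 (mxhorner A) uv.
by rewrite mxhornerD !mxhornerM pA mulmx0 add0r mxhorner1 => /mulmx1_unit[].
Qed.

End HornerMatrix.

(** * Idempotents, locality and split morphisms *)

Section Indecomposable.
Variables (K : fieldType) (Q : quiver).
Implicit Types (M N V W : rep K Q).

Lemma rep_is_zeroP M : rep_is_zero M <-> (forall x, (1%:M : 'M[K]_(rdim M x)) = 0).
Proof.
have mx0 n (A : 'M[K]_n) : n = 0%N -> A = 0.
  by move=> n0; subst n; exact: flatmx0.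
split=> M0 x; first exact: mx0.
by rewrite -(mxrank1 K (rdim M x)) M0 mxrank0.
Qed.

(** Each idempotent has a full-rank factorization [C R] with [R C = 1], and sandwiching the arrow
    maps between these factors makes its image a representation. The two images are complementary
    because [p] and [q] are orthogonal with sum [1]. *)
Lemma idempotent_split M (p q : forall x, 'M[K]_(rdim M x)) :
  is_rep_hom p -> is_rep_hom q ->
  (forall x, p x *m p x = p x) -> (forall x, q x *m q x = q x) ->
  (forall x, p x *m q x = 0) -> (forall x, q x *m p x = 0) ->
  (forall x, p x + q x = 1%:M) ->
  exists U W, [/\ rep_iso M (rep_sum U W),
    forall x, rdim U x = \rank (p x) & forall x, rdim W x = \rank (q x)].
Proof.
move=> hp hq pp qq pq qp p1.
have base (A : forall x, 'M[K]_(rdim M x)) : (forall x, A x *m A x = A x) ->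
    exists (d : vert Q -> nat) (C : forall x, 'M[K]_(rdim M x, d x))
           (R : forall x, 'M[K]_(d x, rdim M x)),
      [/\ forall x, d x = \rank (A x), forall x, C x *m R x = A x &
          forall x, R x *m C x = 1%:M].
  move=> AA; pose C x := col_base (A x); pose R x := row_base (A x).
  have CR x : C x *m R x = A x by exact: mulmx_base.
  exists (fun x => \rank (A x)), C, R; split=> // x.
  (* In [C R C R = C R], the full-rank factors [R] on the right and [C] on the left can be
     cancelled. *)
  apply: (row_free_inj (row_base_free (A x))); rewrite /= mul1mx -/(R x).
  apply: (row_full_inj (col_base_full (A x))); rewrite /= -/(C x).
  by move: (C x) (R x) (CR x) => {C R CR} C R CR; rewrite -mulmxA CR mulmxA CR.
have [d [C [R [dp CR RC]]]] := base p pp.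
have [d' [C' [R' [dq CR' RC']]]] := base q qq.
pose Im (d : vert Q -> nat)
  (R : forall x, 'M[K]_(d x, rdim M x)) (C : forall x, 'M[K]_(rdim M x, d x)) :=
  @Rep K Q d (fun a => R (src a) *m rmap M a *m C (tgt a)).
have Rp x : R x *m p x = R x by rewrite -CR mulmxA RC mul1mx.
have Cp x : p x *m C x = C x by rewrite -CR -mulmxA RC mulmx1.
have Rq x : R' x *m q x = R' x by rewrite -CR' mulmxA RC' mul1mx.
have Cq x : q x *m C' x = C' x by rewrite -CR' -mulmxA RC' mulmx1.
have RC0 x : R x *m C' x = 0.
  by rewrite -Rp -Cq mulmxA -(mulmxA _ (p x)) pq mulmx0 mul0mx.
have RC0' x : R' x *m C x = 0.
  by rewrite -Rq -Cp mulmxA -(mulmxA _ (q x)) qp mulmx0 mul0mx.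
exists (@Im _ R C), (@Im _ R' C'); split=> //.
exists (fun x => row_mx (C x) (C' x)), (fun x => col_mx (R x) (R' x)).
split=> [a|a|x|x] /=.
- rewrite mul_row_block !mulmx0 addr0 add0r mul_mx_row !mulmxA CR CR'.
  by rewrite -hp -hq -!mulmxA Cp Cq.
- rewrite mul_block_col mul_col_mx !mul0mx addr0 add0r -!mulmxA CR CR'.
  by rewrite hp hq !mulmxA Rp Rq.
- by rewrite mul_row_col CR CR' p1.
- by rewrite mul_col_row RC RC' RC0 RC0' -scalar_mx_block.
Qed.

(** Splitting [M] along [p] and [1 - p] leaves one summand zero, so one of the two idempotents has
    rank [0] at every vertex. *)
Lemma indecomposable_idempotent M (p : forall x, 'M[K]_(rdim M x)) :
  indecomposable M -> is_rep_hom p -> (forall x, p x *m p x = p x) ->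
  (forall x, p x = 0) \/ (forall x, p x = 1%:M).
Proof.
move=> [_ indM] hp pp; pose q x := 1%:M - p x.
have hq : is_rep_hom q by move=> a; rewrite /q mulmxBr mulmxBl mulmx1 mul1mx hp.
have pq x : p x *m q x = 0 by rewrite /q mulmxBr mulmx1 pp subrr.
have qp x : q x *m p x = 0 by rewrite /q mulmxBl mul1mx pp subrr.
have qq x : q x *m q x = q x by rewrite {1}/q mulmxBl mul1mx pq subr0.
have p1 x : p x + q x = 1%:M by rewrite /q addrC subrK.
have [U [W [/indM[U0|W0] dU dW]]] := idempotent_split hp hq pp qq pq qp p1.
- by left=> x; apply/eqP; rewrite -mxrank_eq0 -dU U0.
- right=> x; have/eqP := W0 x; rewrite dW mxrank_eq0 => /eqP q0.
  by have := p1 x; rewrite q0 addr0.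
Qed.

(* Fitting's lemma.  With chi = X^k r annihilating f and r(0) <> 0, a Bezout
   relation u X^k + v r = 1 turns (u X^k)(f) into an idempotent endomorphism. *)
Lemma indecomposable_local M (f : forall x, 'M[K]_(rdim M x)) :
  indecomposable M -> is_rep_hom f ->
  (forall x, f x \in unitmx) \/ (forall x, 1%:M - f x \in unitmx).
Proof.
(* The product over all vertices annihilates [f] at every vertex at once, so a single Bezout
   relation serves the whole representation. *)
move=> indM hf; pose chi : {poly K} := \prod_x char_poly (f x).
have chif x : mxhorner (f x) chi = 0.
  apply: mxhorner_dvd (mxhorner_char_poly (f x)).
  by rewrite /chi (bigD1 x) //= dvdp_mulr.
have chi_neq0 : chi != 0.
  by apply/monic_neq0/monic_prod => x _; exact: char_poly_monic.
have [k [r]] := multiplicity_XsubC chi 0.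
rewrite chi_neq0 /= polyC0 subr0 => r0 chiE.
have cr : coprimep r 'X by rewrite coprimepX.
have /Bezout_eq1_coprimepP[[u v] /= uv] : coprimep 'X^k r.
  by rewrite coprimep_expl // coprimep_sym.
pose h (p : {poly K}) x := mxhorner (f x) p.
have hom_h p : is_rep_hom (h p) by move=> a; exact: mxhorner_intertwine.
have uv0 p x : h (p * ('X^k * r)) x = 0.
  by rewrite /h mxhornerM mulrC -chiE chif mulmx0.
have idem x : h (u * 'X^k) x *m h (u * 'X^k) x = h (u * 'X^k) x.
  rewrite -mxhornerM -[RHS]mulmx1 -(mxhorner1 (f x)) -uv mxhornerD mulmxDr.
  rewrite -!mxhornerM -[X in _ = _ + X]/(h _ x).
  have -> : u * 'X^k * (v * r) = u * v * ('X^k * r) by rewrite mulrACA.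
  by rewrite uv0 addr0.
have [h0|h1] := indecomposable_idempotent indM (hom_h _) idem.
(* Here [f] is nilpotent, and [1 - X] is coprime to [X^k]. *)
- right=> x; have Xk0 : h 'X^k x = 0.
    rewrite /h -[LHS]mulmx1 -(mxhorner1 (f x)) -uv mxhornerD.
    rewrite -[mxhorner _ (u * _)]/(h _ x) h0 add0r -mxhornerM.
    by rewrite mulrCA; exact: uv0.
  have := @mxhorner_unit _ _ (f x) 'X^k (1 - 'X) _ Xk0.
  rewrite -['X]mul1r -mulNr -polyCN mxhornerD mxhornerM mxhorner1 mxhornerC.
  rewrite mul1r mxhornerX mul_scalar_mx scaleN1r; apply.
  rewrite polyCN mulN1r coprimep_expl // coprimep_sym coprimepX.
  by rewrite rootE !hornerE subr0 oner_eq0.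
(* Here [r(f) = 0], and [X] is coprime to [r]. *)
- left=> x; rewrite -(mxhornerX (f x)); apply: mxhorner_unit cr _.
  rewrite -[LHS]mulmx1 -(h1 x) -mxhornerM mulrCA [r * _]mulrC.
  exact: uv0.
Qed.

Lemma rep_hom_comp V W N (f : forall x, 'M[K]_(rdim V x, rdim W x))
    (g : forall x, 'M[K]_(rdim W x, rdim N x)) :
  is_rep_hom f -> is_rep_hom g -> is_rep_hom (fun x => f x *m g x).
Proof. by move=> hf hg a; rewrite mulmxA hf -mulmxA hg mulmxA. Qed.

Lemma rep_hom_inv M (f : forall x, 'M[K]_(rdim M x)) :
  is_rep_hom f -> (forall x, f x \in unitmx) -> is_rep_hom (fun x => invmx (f x)).
Proof.
move=> hf uf a; apply: (can_inj (mulmxK (uf (tgt a)))).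
by rewrite -!mulmxA mulVmx // mulmx1 hf mulmxA mulVmx // mul1mx.
Qed.

(** Locality is applied to [f (f + g)^-1], whose complement to [1] is [g (f + g)^-1]. *)
Lemma indecomposable_unitD M (f g : forall x, 'M[K]_(rdim M x)) :
  indecomposable M -> is_rep_hom f -> is_rep_hom g ->
  (forall x, f x + g x \in unitmx) ->
  (forall x, f x \in unitmx) \/ (forall x, g x \in unitmx).
Proof.
move=> indM hf hg ufg; pose u x := invmx (f x + g x).
have hu : is_rep_hom u.
  by apply: rep_hom_inv => // a; rewrite mulmxDr mulmxDl hf hg.
have [uf|ug] := indecomposable_local indM (rep_hom_comp hf hu).
  by left=> x; have := uf x; rewrite unitmx_mul => /andP[].
right=> x; have := ug x.
rewrite -(mulmxV (ufg x)) mulmxDl addrC addKr.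
by rewrite unitmx_mul => /andP[].
Qed.

(** Correcting [g] by [(f g)^-1] gives a right inverse [g'] of [f]. Then [g' f] is an idempotent of
    [N]; it is not [0], since that would force [1 = 0] on [M], so it is [1]. *)
Lemma indecomposable_iso M N (f : forall x, 'M[K]_(rdim M x, rdim N x))
    (g : forall x, 'M[K]_(rdim N x, rdim M x)) :
  indecomposable M -> indecomposable N -> is_rep_hom f -> is_rep_hom g ->
  (forall x, f x *m g x \in unitmx) -> rep_iso M N.
Proof.
move=> [M0 _] indN hf hg ufg.
pose g' x := g x *m invmx (f x *m g x).
have hg' : is_rep_hom g'.
  by apply: rep_hom_comp => //; apply: rep_hom_inv => //; exact: rep_hom_comp.
have fg' x : f x *m g' x = 1%:M by rewrite mulmxA mulmxV.
have idem x : g' x *m f x *m (g' x *m f x) = g' x *m f x.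
  by rewrite -mulmxA (mulmxA (f x)) fg' mul1mx.
have [p0|p1] := indecomposable_idempotent indN (rep_hom_comp hg' hf) idem.
- case: M0; apply/rep_is_zeroP => x.
  by rewrite -fg' -[g' x]mulmx1 -(fg' x) (mulmxA (g' x)) p0 mul0mx mulmx0.
- by exists f, g'.
Qed.

End Indecomposable.

(** * Multiplicity of an indecomposable *)

(** A subspace of maximal dimension inside [P] contains every vector of [P]: adjoining the line of a
    further one would raise the dimension. *)
Lemma subspace_exists (K : fieldType) (vT : vectType K) (P : vT -> Prop) :
  P 0 -> (forall c u v, P u -> P v -> P (c *: u + v)) ->
  exists U : {vspace vT}, forall v, v \in U <-> P v.
Proof.
move=> P0 PD.
pose q (n : nat) :=
  `[< exists U : {vspace vT}, (forall v, v \in U -> P v) /\ \dim U = n >].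
have ex_q : exists n, q n.
  exists 0%N; apply/asboolP; exists 0%VS; rewrite dimv0; split=> // v.
  by rewrite memv0 => /eqP ->.
have ub_q n : q n -> (n <= \dim {:vT})%N.
  by move=> /asboolP[U [_ <-]]; apply: dimvS; exact: subvf.
case: (ex_maxnP ex_q ub_q) => n /asboolP[U [UP dimU]] max_n.
exists U => v; split=> [|Pv]; first exact: UP.
have : q (\dim (U + <[v]>)).
  apply/asboolP; exists (U + <[v]>)%VS; split=> // x /memv_addP[u uU [w]].
  by move=> /vlineP[k wE] xE; rewrite xE wE addrC; apply: PD => //; exact: UP.
move=> /max_n; rewrite -dimU => dimUv; have /eqP -> : U == (U + <[v]>)%VS.
  by rewrite eqEdim addvSl.
by rewrite (subvP (addvSr U <[v]>)) ?memv_line.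
Qed.

(** * Linear subfunctors of [Hom(M, -)] and their dimensions *)

Section SubfunctorOfHom.
Variables (K : fieldType) (Q : quiver) (M : rep K Q).
Implicit Types V W : rep K Q.

Definition family V := forall x, 'M[K]_(rdim M x, rdim V x).

(** Flattening a dependent family of matrices into one finite function gives a finite dimensional
    vector space, in which [\dim] makes sense. *)
Definition fcoord V := {ffun {x : vert Q & 'I_(rdim M x) * 'I_(rdim V x)}%type -> K^o}.

Definition of_fcoord V (h : fcoord V) : family V :=
  fun x => \matrix_(i, j) h (Tagged (fun x => 'I_(rdim M x) * 'I_(rdim V x))%type (i, j)).

Definition to_fcoord V (f : family V) : fcoord V :=
  [ffun t => f (tag t) (tagged t).1 (tagged t).2].

Lemma to_fcoordK V (f : family V) x : of_fcoord (to_fcoord f) x = f x.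
Proof. by apply/matrixP => i j; rewrite mxE ffunE. Qed.

Lemma of_fcoordP V c (h k : fcoord V) x :
  of_fcoord (c *: h + k) x = c *: of_fcoord h x + of_fcoord k x.
Proof. by apply/matrixP => i j; rewrite !mxE !ffunE. Qed.

Definition postcomp V W (g : forall x, 'M[K]_(rdim V x, rdim W x))
  (h : fcoord V) : fcoord W := to_fcoord (fun x => of_fcoord h x *m g x).

Lemma postcomp_is_linear V W g : linear (@postcomp V W g).
Proof.
move=> c h k; apply/ffunP => -[x [i j]]; rewrite !ffunE /=.
by rewrite of_fcoordP mulmxDl -scalemxAl !mxE.
Qed.

HB.instance Definition _ V W g := GRing.isLinear.Build K (fcoord V) (fcoord W)
  *:%R (@postcomp V W g) (@postcomp_is_linear V W g).

Lemma postcomp_comp V W U (g : forall x, 'M[K]_(rdim V x, rdim W x))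
    (k : forall x, 'M[K]_(rdim W x, rdim U x)) h :
  postcomp k (postcomp g h) = postcomp (fun x => g x *m k x) h.
Proof.
by apply/ffunP => -[x [i j]]; rewrite !ffunE /= to_fcoordK mulmxA.
Qed.

Lemma eq_postcomp V W (g k : forall x, 'M[K]_(rdim V x, rdim W x)) h :
  (forall x, g x = k x) -> postcomp g h = postcomp k h.
Proof. by move=> gk; apply/ffunP => -[x [i j]]; rewrite !ffunE /= gk. Qed.

Lemma postcomp1 V h : @postcomp V V (fun=> 1%:M) h = h.
Proof. by apply/ffunP => -[x [i j]]; rewrite !ffunE /= mulmx1 mxE. Qed.

Lemma postcomp0 V W h : @postcomp V W (fun=> 0) h = 0.
Proof. by apply/ffunP => -[x [i j]]; rewrite !ffunE /= mulmx0 mxE. Qed.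

Lemma postcompD V W (g k : forall x, 'M[K]_(rdim V x, rdim W x)) h :
  postcomp (fun x => g x + k x) h = postcomp g h + postcomp k h.
Proof. by apply/ffunP => -[x [i j]]; rewrite !ffunE /= mulmxDr mxE. Qed.

Variable P : forall V, family V -> Prop.
Arguments P : clear implicits.

(** The first clause allows replacing a family by a pointwise equal one, as happens when passing
    through coordinates. *)
Definition subfunctor : Prop :=
  [/\ forall V (f f' : family V), (forall x, f x = f' x) -> P V f -> P V f',
      forall V, P V (fun=> 0),
      forall V c (f g : family V), P V f -> P V g -> P V (fun x => c *: f x + g x)
    & forall V W (f : family V) (g : forall x, 'M[K]_(rdim V x, rdim W x)),
        P V f -> is_rep_hom g -> P W (fun x => f x *m g x)].

(** The default [0] is never taken when [P] is a subfunctor, by [mem_subspace]. *)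
Definition subspace V : {vspace fcoord V} :=
  xget 0%VS [set U : {vspace fcoord V} | forall h, h \in U <-> P V (of_fcoord h)].

Hypothesis sfP : subfunctor.

Lemma mem_subspace V h : h \in subspace V <-> P V (of_fcoord h).
Proof.
have [Peq P0 PD _] := sfP.
have [|c u v Pu Pv|U HU] := @subspace_exists _ (fcoord V) (fun h => P V (of_fcoord h)).
- by apply: Peq (P0 V) => x; apply/matrixP => i j; rewrite !mxE ffunE.
- by apply: Peq (PD _ c _ _ Pu Pv) => x; rewrite of_fcoordP.
rewrite /subspace; case: xgetP => [S _|/(_ U)]; first exact.
by case.
Qed.

Lemma postcomp_subspace V W (g : forall x, 'M[K]_(rdim V x, rdim W x)) h :
  is_rep_hom g -> h \in subspace V -> postcomp g h \in subspace W.
Proof.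
have [Peq _ _ PM] := sfP.
move=> hg /mem_subspace Ph; apply/mem_subspace.
by apply: Peq (PM _ _ _ _ Ph hg) => x; rewrite to_fcoordK.
Qed.

(** Postcomposing with [k] undoes postcomposing with [g], which is therefore injective. *)
Lemma dim_postcomp V W (g : forall x, 'M[K]_(rdim V x, rdim W x))
    (k : forall x, 'M[K]_(rdim W x, rdim V x)) (U : {vspace fcoord V}) :
  (forall x, g x *m k x = 1%:M) ->
  \dim (linfun (postcomp g) @: U) = \dim U.
Proof.
move=> gk; apply: limg_dim_eq; apply/eqP; rewrite -subv0.
apply/subvP => h /memv_capP[_]; rewrite memv_ker lfunE /= => /eqP h0.
rewrite memv0 -(postcomp1 h) -(eq_postcomp _ gk) -postcomp_comp h0.
by rewrite linear0.
Qed.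

Lemma dim_subspace_le V W (g : forall x, 'M[K]_(rdim V x, rdim W x))
    (k : forall x, 'M[K]_(rdim W x, rdim V x)) :
  is_rep_hom g -> (forall x, g x *m k x = 1%:M) ->
  (\dim (subspace V) <= \dim (subspace W))%N.
Proof.
move=> hg gk; rewrite -(dim_postcomp _ gk); apply: dimvS.
by apply/subvP => _ /memv_imgP[h hV ->]; rewrite lfunE; exact: postcomp_subspace.
Qed.

Lemma dim_subspace_iso V W :
  rep_iso V W -> \dim (subspace V) = \dim (subspace W).
Proof.
case=> g [h [hg hh gh hg1]]; apply/eqP; rewrite eqn_leq.
by rewrite (dim_subspace_le hg gh) (dim_subspace_le hh hg1).
Qed.

(** The injections and projections of the direct sum are morphisms, so they preserve the subfunctor;
    its value at the sum is the internal direct sum of the images of its values at [V] and [W]. *)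
Lemma dim_subspace_sum V W :
  \dim (subspace (rep_sum V W)) = (\dim (subspace V) + \dim (subspace W))%N.
Proof.
pose S := rep_sum V W.
pose i1 x : 'M[K]_(rdim V x, rdim S x) := row_mx 1%:M 0.
pose i2 x : 'M[K]_(rdim W x, rdim S x) := row_mx 0 1%:M.
pose p1 x : 'M[K]_(rdim S x, rdim V x) := col_mx 1%:M 0.
pose p2 x : 'M[K]_(rdim S x, rdim W x) := col_mx 0 1%:M.
have hi1 : is_rep_hom i1.
  move=> a; rewrite /i1 mul_row_block mul_mx_row.
  by rewrite !mulmx1 !mul1mx !mulmx0 !mul0mx !addr0.
have hi2 : is_rep_hom i2.
  move=> a; rewrite /i2 mul_row_block mul_mx_row.
  by rewrite !mulmx1 !mul1mx !mulmx0 !mul0mx !add0r.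
have hp1 : is_rep_hom p1.
  move=> a; rewrite /p1 mul_block_col mul_col_mx.
  by rewrite !mulmx1 !mul1mx !mulmx0 !mul0mx !addr0.
have hp2 : is_rep_hom p2.
  move=> a; rewrite /p2 mul_block_col mul_col_mx.
  by rewrite !mulmx1 !mul1mx !mulmx0 !mul0mx !add0r.
have ip1 x : i1 x *m p1 x = 1%:M by rewrite mul_row_col mulmx1 mulmx0 addr0.
have ip2 x : i2 x *m p2 x = 1%:M by rewrite mul_row_col mulmx1 mulmx0 add0r.
have ip12 x : i1 x *m p2 x = 0 by rewrite mul_row_col mulmx0 mul0mx addr0.
have pi1 x : p1 x *m i1 x + p2 x *m i2 x = 1%:M.
  by rewrite !mul_col_row !mulmx1 !mulmx0 add_block_mx !addr0 !add0r
    -scalar_mx_block.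
rewrite -(dim_postcomp (subspace V) ip1) -(dim_postcomp (subspace W) ip2).
rewrite -dimv_disjoint_sum.
  congr (\dim _); apply/eqP; rewrite eqEsubv; apply/andP; split.
    apply/subvP => h hS; apply/memv_addP.
    exists (postcomp i1 (postcomp p1 h)).
      by apply/memv_imgP; exists (postcomp p1 h);
        rewrite ?lfunE //; exact: postcomp_subspace.
    exists (postcomp i2 (postcomp p2 h)).
      by apply/memv_imgP; exists (postcomp p2 h);
        rewrite ?lfunE //; exact: postcomp_subspace.
    by rewrite !postcomp_comp -postcompD (eq_postcomp _ pi1) postcomp1.
  rewrite subv_add; apply/andP; split;
    by apply/subvP => _ /memv_imgP[h hV ->]; rewrite lfunE; exact: postcomp_subspace.
apply/eqP; rewrite -subv0; apply/subvP => k /memv_capP[].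
move=> /memv_imgP[h _ ->] /memv_imgP[h']; rewrite !lfunE /= => _ E.
(* Projecting to [W] kills the element coming from [V] and returns [h'], so the intersection is
   zero. *)
have := congr1 (postcomp p2) E.
rewrite !postcomp_comp (eq_postcomp _ ip12) (eq_postcomp _ ip2) postcomp0 postcomp1.
by move=> h'0; rewrite E -h'0 linear0 mem0v.
Qed.

End SubfunctorOfHom.

(** * The radical and the multiplicity functional *)

Section Multiplicity.
Variables (K : fieldType) (Q : quiver) (M : rep K Q).
Hypothesis indM : indecomposable M.
Implicit Types V W : rep K Q.

Definition hom_pred V (f : family M V) : Prop := is_rep_hom f.

(* The radical of the category of representations, restricted to the
   morphisms with source M. *)
Definition rad_pred V (f : family M V) : Prop :=
  is_rep_hom f /\ forall g : forall x, 'M[K]_(rdim V x, rdim M x),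
    is_rep_hom g -> ~ (forall x, f x *m g x \in unitmx).

Lemma hom_subfunctor : subfunctor hom_pred.
Proof.
split=> [V f f' ff' hf a|V a|V c f g hf hg a|V W f g hf hg].
- by rewrite -!ff'.
- by rewrite mulmx0 mul0mx.
- by rewrite mulmxDr mulmxDl -scalemxAl -scalemxAr hf hg.
- exact: rep_hom_comp.
Qed.

(** Locality gives closure under sums: if [(c f + f') g] is invertible, so is [(c f) g] or [f' g].
    The zero family qualifies because [M] is nonzero. *)
Lemma rad_subfunctor : subfunctor rad_pred.
Proof.
have [Heq H0 HD HM] := hom_subfunctor.
split=> [V f f' ff' [hf nf]|V|V c f f' [hf nf] [hf' nf']|V W f g [hf nf] hg].
- split=> [|g hg uf']; first exact: Heq hf.
  by apply: (nf g hg) => x; rewrite ff'.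
- split=> [|g hg u0]; first exact: H0.
  case: indM => + _; apply; apply/rep_is_zeroP => x.
  by have := u0 x; rewrite mul0mx => u; rewrite -(mulmxV u) mul0mx.
- split=> [|g hg ufg]; first exact: HD.
  have hcf : is_rep_hom (fun x => (c *: f x) *m g x).
    by apply: rep_hom_comp => // a; rewrite -scalemxAl -scalemxAr hf.
  have [x|uf|uf'] := indecomposable_unitD indM hcf (rep_hom_comp hf' hg).
  + by rewrite -mulmxDl; exact: ufg.
  + apply: (nf (fun x => c *: g x)) => [a|x].
      by rewrite -scalemxAl -scalemxAr hg.
    by rewrite -scalemxAr scalemxAl.
  + exact: nf' hg uf'.
- split=> [|k hk ufgk]; first exact: HM.
  apply: (nf (fun x => g x *m k x)); first exact: rep_hom_comp.
  by move=> x; rewrite mulmxA.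
Qed.

(** This is the number of summands [M] in [V] times the dimension of the residue division algebra of
    [M]; its value at [M] is thus nonzero, but not always [1]. *)
Definition multiplicity V : int :=
  (\dim (subspace hom_pred V))%:Z - (\dim (subspace rad_pred V))%:Z.

Lemma multiplicity_iso V W : rep_iso V W -> multiplicity V = multiplicity W.
Proof.
move=> VW; rewrite /multiplicity (dim_subspace_iso hom_subfunctor VW).
by rewrite (dim_subspace_iso rad_subfunctor VW).
Qed.

Lemma multiplicity_sum V W :
  multiplicity (rep_sum V W) = multiplicity V + multiplicity W.
Proof.
rewrite /multiplicity (dim_subspace_sum hom_subfunctor).
by rewrite (dim_subspace_sum rad_subfunctor) !PoszD opprD addrACA.
Qed.

(** The identity of [M] is a morphism outside the radical. *)
Lemma multiplicity_self : multiplicity M != 0.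
Proof.
rewrite /multiplicity subr_eq0 eqz_nat; apply/eqP => dimE.
have : subspace rad_pred M == subspace hom_pred M.
  rewrite eqEdim dimE leqnn andbT; apply/subvP => h.
  by move=> /(mem_subspace rad_subfunctor)[hh _]; apply/(mem_subspace hom_subfunctor).
move=> /eqP radE.
have : to_fcoord (fun x => 1%:M : 'M[K]_(rdim M x)) \in subspace rad_pred M.
  rewrite radE; apply/(mem_subspace hom_subfunctor) => a.
  by rewrite !to_fcoordK mulmx1 mul1mx.
move=> /(mem_subspace rad_subfunctor)[_ /(_ (fun=> 1%:M))]; apply.
  by move=> a; rewrite mulmx1 mul1mx.
by move=> x; rewrite to_fcoordK mulmx1 unitmx1.
Qed.

(** A morphism from [M] to [N] outside the radical would be an isomorphism, by
    [indecomposable_iso]. *)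
Lemma multiplicity_other N :
  indecomposable N -> ~ rep_iso M N -> multiplicity N = 0.
Proof.
move=> indN MN; rewrite /multiplicity; apply/eqP; rewrite subr_eq0; apply/eqP.
congr (Posz (\dim _)); apply/eqP; rewrite eqEsubv; apply/andP; split.
  apply/subvP => h /(mem_subspace hom_subfunctor) hh.
  apply/(mem_subspace rad_subfunctor); split=> // g hg ufg; apply: MN.
  exact: indecomposable_iso hh hg ufg.
apply/subvP => h /(mem_subspace rad_subfunctor)[hh _].
exact/(mem_subspace hom_subfunctor).
Qed.

End Multiplicity.

(** * Independence of indecomposables in the representation ring *)

Lemma additive_rep_ring (K : fieldType) (Q : quiver) (s : rep K Q -> int)
    (s_iso : forall V W, rep_iso V W -> s V = s W)
    (s_sum : forall V W, s (rep_sum V W) = s V + s W) :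
  exists2 f : {additive rep_ring K Q -> int}, True & forall V, f (rep_class V) = s V.
Proof.
pose F := zlift (fun c : isoclass K Q => s (repr c)).
have FU V : F << icls V >> = s V by rewrite /F zliftU; apply/s_iso/repr_icls.
have FB x y : F (x - y) = F x - F y by exact: raddfB.
(* The kernel of [F] is a subgroup containing the relations, hence contains the smallest such
   subgroup. *)
have F0 D : D \in @sum_subgroup K Q -> F D = 0.
  move=> /asboolP/(_ (fun D => F D = 0)); apply; split=> [|_ [V [W ->]]].
    by split=> [|x y /= Fx Fy]; [exact: raddf0|rewrite FB Fx Fy subrr].
  by rewrite !FB !FU s_sum -addrA -opprD subrr.
pose f (r : rep_ring K Q) := F (repr r).
have fpi D : f (\pi_(rep_ring K Q) D)%qT = F D.
  apply/eqP; rewrite -subr_eq0 -FB; apply/eqP/F0.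
  by rewrite Quotient.idealrBE reprK.
have fB : zmod_morphism f.
  elim/rep_ringW => x; elim/rep_ringW => y.
  have -> : (\pi_(rep_ring K Q) x - \pi_(rep_ring K Q) y)%qT
      = (\pi_(rep_ring K Q) (x - y))%qT by rewrite raddfB.
  by rewrite !fpi FB.
pose fA := GRing.isZmodMorphism.Build _ _ f fB.
exists (HB.pack f fA : {additive rep_ring K Q -> int}) => // V.
exact: etrans (fpi _) (FU V).
Qed.

(** The multiplicity functional of [V i] kills every other term and leaves [c i] times a nonzero
    integer. *)
Lemma rep_class_free (K : fieldType) (Q : quiver) (I : finType)
    (V : I -> rep K Q) (c : I -> int) :
  (forall i, indecomposable (V i)) ->
  (forall i j, i <> j -> ~ rep_iso (V i) (V j)) ->
  \sum_i rep_class (V i) *~ c i = 0 -> forall i, c i = 0.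
Proof.
move=> indV VN Vc0 i.
have [f _ fE] := additive_rep_ring (multiplicity_iso (indV i))
  (multiplicity_sum (indV i)).
have := congr1 f Vc0; rewrite raddf0 raddf_sum (bigD1 i) //= big1.
  rewrite addr0 raddfMz fE -mulrzr => /eqP; rewrite mulf_eq0 intz.
  by rewrite (negPf (multiplicity_self _)) //= => /eqP.
move=> j /eqP ji; rewrite raddfMz fE multiplicity_other ?mul0rz //.
by apply: VN => ij; apply: ji.
Qed.

(** * Linearization and counting morphisms *)

Lemma bijective_of_surj (A B : Type) (f : A -> B) :
  injective f -> (forall y, exists x, f x = y) -> bijective f.
Proof.
move=> f_inj f_surj; pose g y := sval (cid (f_surj y)).
have gK : cancel g f by move=> y; rewrite /g; case: cid.
by exists g => // x; apply: f_inj; rewrite gK.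
Qed.

Section Linearization.
Variables (K : fieldType) (Q : quiver).
Implicit Types X Y : qover Q.

Definition in_fiber X x (v : vert (odom X)) (vx : mvert (str X) v == x) :
  fiber X x := exist (fun v => mvert (str X) v == x) v vx.

Definition arrow_count X (a : arr Q) (u v : vert (odom X)) : nat :=
  (\sum_(b : arr (odom X)) [&& marr (str X) b == a, src b == u & tgt b == v])%N.

Lemma rmap_linearization X a i j :
  rmap (linearization K X) a i j
  = (arrow_count a (val (enum_val i)) (val (enum_val j)))%:R.
Proof.
rewrite /= summxE /arrow_count natr_sum big_mkcond /=; apply: eq_bigr => b _.
by rewrite mxE ![val (enum_val _) == _]eq_sym; case: eqP.
Qed.

(** This reduces each isomorphism with a linearization below to a bijection of bases and a count of
    arrows. *)
Lemma linearization_iso (V : rep K Q) X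
    (c : forall x, 'I_(rdim V x) -> fiber X x) :
  (forall x, injective (c x)) -> (forall x u, exists i, c x i = u) ->
  (forall a i j, rmap V a i j = (arrow_count a (val (c _ i)) (val (c _ j)))%:R) ->
  rep_iso V (linearization K X).
Proof.
move=> c_inj c_surj cE.
have [d [cK dK]] : exists d : forall x, fiber X x -> 'I_(rdim V x),
    (forall x, cancel (c x) (d x)) /\ (forall x, cancel (d x) (c x)).
  pose d x (u : fiber X x) := sval (cid (c_surj x u)).
  have dK x : cancel (d x) (c x) by move=> u; rewrite /d; case: cid.
  by exists d; split=> // x i; apply: c_inj; rewrite dK.
apply: (@rep_iso_reindex _ _ V (linearization K X)
  (fun x i => enum_rank (c x i)) (fun x i => d x (enum_val i))) => [x i|x i|a i j].
- by rewrite enum_rankK cK.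
- by rewrite dK enum_valK.
- by rewrite rmap_linearization !enum_rankK cE.
Qed.

Lemma mvert_ohom X Y (f : ohom X Y) u :
  mvert (str Y) (mvert (val f) u) = mvert (str X) u.
Proof. by have := congr1 (@mvert _ _^~ u) (eqP (valP f)); rewrite mvertE. Qed.

Lemma marr_ohom X Y (f : ohom X Y) b :
  marr (str Y) (marr (val f) b) = marr (str X) b.
Proof. by have := congr1 (@marr _ _^~ b) (eqP (valP f)); rewrite marrE. Qed.

Lemma ohomP X Y (f g : ohom X Y) :
  mvert (val f) =1 mvert (val g) -> marr (val f) =1 marr (val g) -> f = g.
Proof. by move=> fgv fga; apply: val_inj; exact: qmorP. Qed.

Lemma ocompA X Y Z W (h : ohom Z W) (g : ohom Y Z) (f : ohom X Y) :
  ocomp h (ocomp g f) = ocomp (ocomp h g) f.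
Proof. by apply: val_inj; exact: qcompA. Qed.

Lemma oid_comp X Y (f : ohom X Y) : ocomp (oid Y) f = f.
Proof.
by apply: ohomP => u; rewrite ?(mvertE, marrE) /= ?(mvertE, marrE).
Qed.

Lemma invertible_cancel X Y (f : ohom X Y) (g : ohom Y X) : ocomp g f = oid X ->
  cancel (mvert (val f)) (mvert (val g)) /\ cancel (marr (val f)) (marr (val g)).
Proof.
move=> /(congr1 val) /= gf; split=> u.
  by have := congr1 (fun h => mvert h u) gf; rewrite !mvertE.
by have := congr1 (fun h => marr h u) gf; rewrite !marrE.
Qed.

Lemma linearization_oiso X Y :
  oiso X Y -> rep_iso (linearization K X) (linearization K Y).
Proof.
case=> f [g [gf fg]].
have [fvK faK] := invertible_cancel gf; have [gvK gaK] := invertible_cancel fg.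
have fib x (u : fiber X x) : mvert (str Y) (mvert (val f) (val u)) == x.
  by rewrite mvert_ohom; exact: (valP u).
have gib x (u : fiber Y x) : mvert (str X) (mvert (val g) (val u)) == x.
  by rewrite mvert_ohom; exact: (valP u).
apply: (@linearization_iso (linearization K X) Y
  (fun x i => in_fiber (fib x (enum_val i))))
  => [x i j /(congr1 val)|x u|a i j].
- by rewrite !SubK => /(can_inj fvK)/val_inj/enum_val_inj.
- exists (enum_rank (in_fiber (gib x u))).
  by apply: val_inj; rewrite SubK enum_rankK SubK gvK.
- rewrite rmap_linearization !SubK; congr (_%:R); rewrite /arrow_count.
  rewrite [RHS](reindex (marr (val f))) /=; last first.
    by exists (marr (val g)) => b _.
  apply: eq_bigr => b _.
  by rewrite marr_ohom marr_src marr_tgt !(can_eq fvK).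
Qed.

(** An arrow of the fiber product over [a] is an arbitrary pair of arrows over [a]. *)
Lemma arrow_count_fiber_product X Y a (u v : vert (odom (fiber_product X Y))) :
  arrow_count a u v = (arrow_count a (val u).1 (val v).1
                       * arrow_count a (val u).2 (val v).2)%N.
Proof.
rewrite /arrow_count big_distrlr pair_bigA /=.
pose F (p : arr (odom X) * arr (odom Y)) : nat :=
  ([&& marr (str X) p.1 == a, src p.1 == (val u).1 & tgt p.1 == (val v).1]
  * [&& marr (str Y) p.2 == a, src p.2 == (val u).2 & tgt p.2 == (val v).2])%N.
rewrite [RHS](bigID (fun p => marr (str X) p.1 == marr (str Y) p.2)) /=.
(* Two arrows with different images in [Q] cannot both lie over [a], so such pairs contribute
   [0]. *)
rewrite [X in (_ + X)%N]big1 ?addn0; last first.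
  move=> p; have [->|_ _] := eqVneq (marr (str X) p.1) a; last by rewrite mul0n.
  by rewrite eq_sym => /negPf ->; rewrite muln0.
transitivity (\sum_(p in [pred p | marr (str X) p.1 == marr (str Y) p.2]) F p)%N;
  last by apply: eq_big.
transitivity (\sum_(b : fp_arr X Y) F (val b))%N; last exact: esym (big_sub _ F).
apply: eq_bigr => -[[b b'] /= bb'] _.
rewrite marrE /F mulnb /= -!val_eqE /= -(eqP bb'); congr nat_of_bool.
rewrite -!pair_eqE /=; case: (_ == a) => //=.
by rewrite !andbA; congr (_ && _); rewrite -!andbA; congr (_ && _); rewrite andbC.
Qed.

(** The tensor of the basis vectors of [u] and [v] corresponds to the basis vector of the vertex
    [(u, v)]. *)
Lemma linearization_fiber_product X Y :
  rep_iso (rep_tensor (linearization K X) (linearization K Y))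
          (linearization K (fiber_product X Y)).
Proof.
have fpv x (u : fiber X x) (v : fiber Y x) :
    mvert (str X) (val u, val v).1 == mvert (str Y) (val u, val v).2.
  by rewrite /= (eqP (valP u)) (eqP (valP v)).
have fpf x (u : fiber X x) (v : fiber Y x) :
    mvert (str (fiber_product X Y))
      (exist _ (val u, val v) (fpv x u v) : fp_vert X Y) == x.
  by rewrite mvertE /=; exact: (valP u).
pose mk x u v : fiber (fiber_product X Y) x :=
  in_fiber (fpf x u v).
have mkE x u v : val (val (@mk x u v)) = (val u, val v) by [].
pose c x (k : 'I_(rdim (rep_tensor (linearization K X) (linearization K Y)) x)) :=
  @mk x (enum_val (mxtens_unindex k).1) (enum_val (mxtens_unindex k).2).
apply: (@linearization_iso _ _ c) => [x k l|x u|a k l].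
- case: (mxtens_indexP k) => i j; case: (mxtens_indexP l) => i' j'.
  rewrite /c !mxtens_indexK /= => /(congr1 val)/(congr1 val).
  rewrite !mkE => -[e1 e2].
  have -> : i = i' by apply/enum_val_inj/val_inj.
  by have -> : j = j' by apply/enum_val_inj/val_inj.
- have uX : mvert (str X) (val (val u)).1 == x 
    by have := valP u; rewrite mvertE.
  have uY : mvert (str Y) (val (val u)).2 == x.
    by rewrite -(eqP (valP (val u))).
  exists (mxtens_index (enum_rank (in_fiber uX),
                        enum_rank (in_fiber uY))).
  rewrite /c mxtens_indexK /= !enum_rankK; apply: val_inj; apply: val_inj.
  exact: esym (surjective_pairing _).
- case: (mxtens_indexP k) => i j; case: (mxtens_indexP l) => i' j'.
  rewrite /c !mxtens_indexK [rmap _ _]/= tensmxE.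
  rewrite -[X in X * _]/(rmap (linearization K X) a i i').
  rewrite -[X in _ * X]/(rmap (linearization K Y) a j j').
  rewrite !rmap_linearization -natrM; congr (_%:R).
  by rewrite arrow_count_fiber_product.
Qed.

Section DisjointUnion.
Variables (I : finType) (F : I -> qover Q).

Lemma arrow_count_disjoint_union a (u v : vert (odom (disjoint_union F))) :
  arrow_count a u v =
  (\sum_i \sum_(b : arr (odom (F i))) [&& marr (str (F i)) b == a,
     Tagged (fun i => vert (odom (F i))) (src b) == u
     & Tagged (fun i => vert (odom (F i))) (tgt b) == v])%N.
Proof. by rewrite sig_big_dep; apply: eq_bigr => -[i b] _; rewrite marrE. Qed.

Lemma arrow_count_Tagged a i (u v : vert (odom (F i))) :
  arrow_count (X := disjoint_union F) a
    (Tagged (fun i => vert (odom (F i))) u) (Tagged (fun i => vert (odom (F i))) v)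
  = arrow_count a u v.
Proof.
rewrite arrow_count_disjoint_union (bigD1 i) //= [X in (_ + X)%N]big1 ?addn0.
  by apply: eq_bigr => b _; rewrite !eq_Tagged.
by move=> j ji; apply: big1 => b _; rewrite -!tag_eqE /tag_eq /= (negPf ji) andbF.
Qed.

Lemma arrow_count_tag_neq a (u v : vert (odom (disjoint_union F))) :
  tag u != tag v -> arrow_count a u v = 0%N.
Proof.
move=> uv; rewrite arrow_count_disjoint_union.
apply: big1 => i _; apply: big1 => b _; apply/eqP; rewrite eqb0.
by apply: contra uv => /and3P[_ /eqP <- /eqP <-].
Qed.

End DisjointUnion.

(** Since [rep_sum] is binary, one component is split off at a time; this is the induction step of
    [rep_class_disjoint_union]. *)
Lemma linearization_disjoint_union (I : finType) (F : I -> qover Q) (i0 : I) :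
  rep_iso (rep_sum (linearization K (F i0)) (linearization K
             (disjoint_union (fun j : {i | i != i0} => F (val j)))))
          (linearization K (disjoint_union F)).
Proof.
pose G (j : {i | i != i0}) := F (val j).
pose DG := disjoint_union G; pose DF := disjoint_union F.
pose V := rep_sum (linearization K (F i0)) (linearization K DG).
pose j1 (v : vert (odom (F i0))) : vert (odom DF) :=
  Tagged (fun i => vert (odom (F i))) v.
pose j2 (w : vert (odom DG)) : vert (odom DF) :=
  @Tagged _ (val (tag w)) (fun i => vert (odom (F i))) (tagged w).
have j1f x (v : fiber (F i0) x) : mvert (str DF) (j1 (val v)) == x.
  by rewrite mvertE; exact: (valP v).
have j2f x (w : fiber DG x) : mvert (str DF) (j2 (val w)) == x.
  by have := valP w; rewrite !mvertE.
pose c x (k : 'I_(rdim V x)) : fiber DF x :=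
  match split k with
  | inl i => in_fiber (j1f x (enum_val i))
  | inr j => in_fiber (j2f x (enum_val j))
  end.
have splitl m n (i : 'I_m) : split (lshift n i) = inl i.
  exact: (unsplitK (inl _ i)).
have splitr m n (i : 'I_n) : split (rshift m i) = inr i.
  exact: (unsplitK (inr _ i)).
have cl x i : val (c x (lshift _ i)) = j1 (val (enum_val i)).
  by rewrite /c splitl.
have cr x i : val (c x (rshift _ i)) = j2 (val (enum_val i)).
  by rewrite /c splitr.
have j1_inj : injective j1 by move=> v v' /eqP; rewrite eq_Tagged => /eqP.
have j2_inj : injective j2.
  move=> [[i ni] w] [[i' ni'] w'] E; have ii : i = i' := congr1 tag E.
  subst i'; have nn : ni = ni' by exact: bool_irrelevance.
  subst ni'; congr existT.
  by move/eqP: E; rewrite eq_Tagged => /eqP.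
have tag_j2 w : tag (j2 w) != i0 by exact: (valP (tag w)).
apply: (@linearization_iso V DF c) => [x k l /(congr1 val)|x [[i v] vx]|a k l].
- case: (split_ordP k) => k' ->; case: (split_ordP l) => l' ->.
  + by rewrite !cl => /j1_inj/val_inj/enum_val_inj ->.
  + by rewrite cl cr => E; have := tag_j2 (val (enum_val l')); rewrite -E eqxx.
  + by rewrite cl cr => E; have := tag_j2 (val (enum_val k')); rewrite E eqxx.
  + by rewrite !cr => /j2_inj/val_inj/enum_val_inj ->.
- have [ii|ni] := eqVneq i i0.
    subst i; have vx' : mvert (str (F i0)) v == x by have := vx; rewrite mvertE.
    exists (lshift _ (enum_rank (in_fiber vx'))).
    by apply: val_inj; rewrite cl enum_rankK.
  pose w : vert (odom DG) := 
    @Tagged _ (exist (fun i => i != i0) i ni) (fun j => vert (odom (G j))) v.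
  have wx : mvert (str DG) w == x by have := vx; rewrite !mvertE.
  exists (rshift _ (enum_rank (in_fiber wx))).
  by apply: val_inj; rewrite cr enum_rankK.
- case: (split_ordP k) => k' ->; case: (split_ordP l) => l' ->;
    rewrite ?cl ?cr.
  + by rewrite block_mxEul arrow_count_Tagged -rmap_linearization.
  + rewrite block_mxEur mxE arrow_count_tag_neq // eq_sym; exact: tag_j2.
  + rewrite block_mxEdl mxE arrow_count_tag_neq //; exact: tag_j2.
  + rewrite block_mxEdr [LHS]rmap_linearization.
    congr (_%:R); move: (val _) (val _) => [[i ni] w] [[i' ni'] w'].
    have [ii|ni'i] := eqVneq i i'.
      subst i'; have nn : ni = ni' by exact: bool_irrelevance.
      by subst ni'; rewrite /j2 /= (@arrow_count_Tagged _ G) (@arrow_count_Tagged _ F).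
    by rewrite (@arrow_count_tag_neq _ G) ?(@arrow_count_tag_neq _ F) // eq_sym.
Qed.

(** For zero [V], the sum of [V] with itself is isomorphic to [V], so [2 [V] = [V]]. *)
Lemma rep_class_is_zero (V : rep K Q) : rep_is_zero V -> rep_class V = 0.
Proof.
move=> V0; have VV0 : rep_is_zero (rep_sum V V) by move=> x /=; rewrite V0.
have /rep_class_iso : rep_iso (rep_sum V V) V.
  exists (fun=> 0), (fun=> 0); split=> [a|a|x|x].
  - by rewrite mulmx0 mul0mx.
  - by rewrite mulmx0 mul0mx.
  - by rewrite mul0mx; apply/esym; move: x; apply/rep_is_zeroP.
  - by rewrite mul0mx; apply/esym; move: x; apply/rep_is_zeroP.
rewrite rep_class_sum => /eqP; rewrite -subr_eq0 addrK => /eqP //.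
Qed.

Lemma rep_class_disjoint_union (I : finType) (F : I -> qover Q) :
  rep_class (linearization K (disjoint_union F))
  = \sum_i rep_class (linearization K (F i)).
Proof.
(* The index type must vary in the induction, the remaining components being indexed by a
   subtype. *)
have [n] := ubnP #|I|; elim: n => // n IH in I F *; rewrite ltnS => cI.
have [i0 _|I0] := pickP (fun _ : I => true).
  rewrite -(rep_class_iso (linearization_disjoint_union F i0)) rep_class_sum.
  rewrite (bigD1 i0) //=; congr (_ + _); rewrite IH.
    exact: esym (big_sub (predC1 i0) (fun i => rep_class (linearization K (F i)))).
  rewrite card_sig; apply: leq_trans cI; rewrite -[X in (_ < X)%N](cardC (pred1 i0)).
  by rewrite card1 add1n ltnS.
rewrite big1; last by move=> i; have := I0 i.
apply: rep_class_is_zero => x /=; apply: eq_card0 => -[[i v] vx].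
by have := I0 i.
Qed.

(** Each vertex and each arrow has itself as only preimage, so the linearization is one-dimensional
    at every vertex with identity maps. *)
Lemma rep_class_over_self : rep_class (linearization K (over_self Q)) = 1.
Proof.
rewrite -rep_class_unit; apply/esym/rep_class_iso.
have fx x : mvert (str (over_self Q)) x == x by rewrite mvertE.
apply: (@linearization_iso (rep_unit K Q) (over_self Q) (fun x _ => in_fiber (fx x))).
- by move=> x i j _; rewrite [i]ord1 [j]ord1.
- move=> x [v vx]; exists ord0; apply: val_inj => /=.
  by move: vx; rewrite mvertE => /eqP.
- move=> a i j; rewrite [i]ord1 [j]ord1 mxE eqxx /arrow_count (bigD1 a) //=.
  rewrite marrE !eqxx big1 // => b /negPf ba.
  by rewrite marrE ba.
Qed.

End Linearization.

(** * Counting morphisms into fiber products and disjoint unions *)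

Section HomCounts.
Variable Q : quiver.
Implicit Types X Y W : qover Q.

Lemma card_ohom_oiso W X Y : oiso X Y -> #|{: ohom W X}| = #|{: ohom W Y}|.
Proof.
have compK (A B : qover Q) (f : ohom A B) (g : ohom B A) :
    ocomp g f = oid A -> cancel (@ocomp Q W A B f) (@ocomp Q W B A g).
  by move=> gf h; rewrite ocompA gf oid_comp.
case=> f [g [gf fg]]; apply: (@bij_eq_card _ _ (@ocomp Q W X Y f)).
by exists (@ocomp Q W Y X g); exact: compK.
Qed.

(** By the universal property, composing with the two projections is a bijection onto pairs of
    morphisms. *)
Lemma card_ohom_fiber_product W X Y :
  #|{: ohom W (fiber_product X Y)}| = (#|{: ohom W X}| * #|{: ohom W Y}|)%N.
Proof.
pose P := fiber_product X Y.
have pairP (A B : Type) (p q : A * B) : p.1 = q.1 -> p.2 = q.2 -> p = q.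
  by case: p q => [a b] [a' b'] /= -> ->.
have p1s (b : arr (odom P)) : src (val b).1 = (val (src b)).1 by [].
have p1t (b : arr (odom P)) : tgt (val b).1 = (val (tgt b)).1 by [].
have p2s (b : arr (odom P)) : src (val b).2 = (val (src b)).2 by [].
have p2t (b : arr (odom P)) : tgt (val b).2 = (val (tgt b)).2 by [].
pose q1 : qmor (odom P) (odom X) := 
    @qmor_of (odom P) _ (fun u => (val u).1) (fun b => (val b).1) p1s p1t.
pose q2 : qmor (odom P) (odom Y) := 
    @qmor_of (odom P) _ (fun u => (val u).2) (fun b => (val b).2) p2s p2t.
have q1P : qcomp (str X) q1 == str P.
  by apply/eqP/qmorP => u; rewrite ?(mvertE, marrE) /= ?(mvertE, marrE).
have q2P : qcomp (str Y) q2 == str P.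
  apply/eqP/qmorP => u; rewrite ?(mvertE, marrE) /= ?(mvertE, marrE);
  exact/esym/eqP/(valP u).
pose p1 : ohom P X := exist _ q1 q1P; pose p2 : ohom P Y := exist _ q2 q2P.
rewrite -card_prod; apply: (@bij_eq_card _ _ (fun h => (ocomp p1 h, ocomp p2 h))).
apply: bijective_of_surj => [h h' E|[f g]].
  have E1 : ocomp p1 h = ocomp p1 h' := congr1 fst E.
  have E2 : ocomp p2 h = ocomp p2 h' := congr1 snd E.
  apply: (@ohomP _ W P) => u; apply: val_inj.
    apply: pairP.
      by have := congr1 (fun h => mvert (val h) u) E1; rewrite !mvertE /= !mvertE.
    by have := congr1 (fun h => mvert (val h) u) E2; rewrite !mvertE /= !mvertE.
  apply: pairP.
    by have := congr1 (fun h => marr (val h) u) E1; rewrite !marrE /= !marrE.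
  by have := congr1 (fun h => marr (val h) u) E2; rewrite !marrE /= !marrE.
have vP (w : vert (odom W)) :
    mvert (str X) (mvert (val f) w, mvert (val g) w).1
    == mvert (str Y) (mvert (val f) w, mvert (val g) w).2.
  by rewrite /= !mvert_ohom.
have aP (b : arr (odom W)) :
    marr (str X) (marr (val f) b, marr (val g) b).1
    == marr (str Y) (marr (val f) b, marr (val g) b).2.
  by rewrite /= !marr_ohom.
pose hv w : vert (odom P) :=
  exist (fun p => mvert (str X) p.1 == mvert (str Y) p.2) _ (vP w).
pose ha b : arr (odom P) :=
  exist (fun p => marr (str X) p.1 == marr (str Y) p.2) _ (aP b).
have hs b : src (ha b) = hv (src b) by apply: val_inj; rewrite /= !marr_src.
have ht b : tgt (ha b) = hv (tgt b) by apply: val_inj; rewrite /= !marr_tgt.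
have hP : qcomp (str P) (qmor_of hs ht) == str W.
  by apply/eqP/qmorP => u; rewrite ?(mvertE, marrE) /= ?(mvertE, marrE) /=
    ?(mvert_ohom, marr_ohom).
exists (exist _ (qmor_of hs ht) hP).
by congr pair; apply: ohomP => u; rewrite ?(mvertE, marrE) /= ?(mvertE, marrE).
Qed.

Lemma Tagged_etagged (I : eqType) (T : I -> Type) (i : I) (u : {i & T i})
  (p : tag u = i) : Tagged T (etagged p) = u.
Proof. by case: u p => j t /= p; subst j. Qed.

(** A morphism from a connected nonempty quiver lands in exactly one component. *)
Lemma card_ohom_disjoint_union W (I : finType) (F : I -> qover Q) :
  connected_quiver (odom W) ->
  #|{: ohom W (disjoint_union F)}| = (\sum_i #|{: ohom W (F i)}|)%N.
Proof.
case=> W_gt0 W_conn; pose D := disjoint_union F.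
have /card_gt0P[w0 _] := W_gt0.
pose TV := fun i => vert (odom (F i)); pose TA := fun i => arr (odom (F i)).
pose jq i : qmor (odom (F i)) (odom D) := @qmor_of (odom (F i)) (odom D)
  (fun v => Tagged TV v) (fun b => Tagged TA b) (fun=> erefl) (fun=> erefl).
have jP i : qcomp (str D) (jq i) == str (F i).
  by apply/eqP/qmorP => u; rewrite ?(mvertE, marrE) /= ?(mvertE, marrE).
pose j i : ohom (F i) D := exist _ (jq i) (jP i).
transitivity #|{: {i & ohom W (F i)}}|; last first.
  rewrite -sum1_card; under [RHS]eq_bigr do rewrite -sum1_card.
  by rewrite sig_big_dep.
apply/esym/(@bij_eq_card _ _ (fun p => ocomp (j (tag p)) (tagged p))).
apply: bijective_of_surj => [[i f] [i' f'] /= E|h].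
  (* The component is read off at [w0]; on an empty quiver it would not be determined by the
     morphism. *)
  have E0 := congr1 (fun h : ohom W D => mvert (val h) w0) E.
  rewrite /= !mvertE /= !mvertE in E0.
  have ii : i = i' := congr1 tag E0; subst i'; congr existT.
  apply: ohomP => u.
    have /eqP := congr1 (fun h : ohom W D => mvert (val h) u) E.
    by rewrite /= !mvertE /= !mvertE eq_Tagged => /eqP.
  have /eqP := congr1 (fun h : ohom W D => marr (val h) u) E.
  by rewrite /= !marrE /= !marrE eq_Tagged => /eqP.
pose i := tag (mvert (val h) w0).
have tag_src b : tag (marr (val h) b) = tag (mvert (val h) (src b)).
  by rewrite -marr_src.
have tag_tgt b : tag (marr (val h) b) = tag (mvert (val h) (tgt b)).
  by rewrite -marr_tgt.
(* The component is constant along arrows followed in either direction, hence along every path from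
   [w0]. *)
have step u v : adjacent u v -> tag (mvert (val h) v) = tag (mvert (val h) u).
  by case/existsP=> b /orP[] /andP[/eqP <- /eqP <-]; rewrite -tag_src -tag_tgt.
have tv w : tag (mvert (val h) w) = i.
  rewrite /i; move: (W_conn w0 w) => /connectP[p hp ->].
  by elim: p (w0) hp => //= u p IH v /andP[/step <- /IH].
have ta b : tag (marr (val h) b) = i by rewrite tag_src tv.
pose gv w : vert (odom (F i)) := @etagged _ TV i _ (tv w).
pose ga b : arr (odom (F i)) := @etagged _ TA i _ (ta b).
have gvE w : Tagged TV (gv w) = mvert (val h) w by exact: Tagged_etagged.
have gaE b : Tagged TA (ga b) = marr (val h) b by exact: Tagged_etagged.
have TV_inj : injective (fun v : vert (odom (F i)) => Tagged TV v).
  by move=> v v' /eqP; rewrite eq_Tagged => /eqP.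
have gs b : src (ga b) = gv (src b).
  by apply: TV_inj; rewrite gvE -marr_src -gaE.
have gt b : tgt (ga b) = gv (tgt b).
  by apply: TV_inj; rewrite gvE -marr_tgt -gaE.
have gP : qcomp (str (F i)) (qmor_of gs gt) == str W.
  apply/eqP/qmorP => u; rewrite ?(mvertE, marrE) /= ?(mvertE, marrE).
    by rewrite -(mvert_ohom h) -gvE mvertE.
  by rewrite -(marr_ohom h) -gaE marrE.
exists (@Tagged _ i (fun i => ohom W (F i)) (exist _ (qmor_of gs gt) gP)).
apply: ohomP => u; rewrite ?(mvertE, marrE) /= ?(mvertE, marrE) /= ?(mvertE, marrE).
  by rewrite gvE.
by rewrite gaE.
Qed.

End HomCounts.

(** * Moebius inversion *)

Section Mobius.
Variables (Q : quiver) (C0 : finType) (ob : C0 -> qover Q).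
Hypothesis C_acyclic : acyclic ob.

Definition hom_count (x y : C0) : nat := #|{: ohom (ob x) (ob y)}|.

Lemma hom_count_self x : hom_count x x = 1%N.
Proof. by apply/eqP/fintype1P; exists (oid (ob x)) => f; exact: C_acyclic.1. Qed.

(** Both composites of opposite morphisms are endomorphisms, hence identities, so the morphisms are
    invertible. *)
Lemma hom_count_antisym x y :
  (0 < hom_count x y)%N -> (0 < hom_count y x)%N -> x = y.
Proof.
move=> /card_gt0P[f _] /card_gt0P[g _].
have [|e _] := C_acyclic.2 x y f; last exact: e.
by exists g; split; exact: C_acyclic.1.
Qed.

Lemma hom_count_trans x y z :
  (0 < hom_count x y)%N -> (0 < hom_count y z)%N -> (0 < hom_count x z)%N.
Proof.
by move=> /card_gt0P[f _] /card_gt0P[g _]; apply/card_gt0P; exists (ocomp g f).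
Qed.

(* The down-set cardinality is strictly increasing along nonidentity morphisms,
   so only the identity contributes to the Leibniz formula. *)
Lemma det_hom_mx : \det (hom_mx ob) = 1.
Proof.
pose down (i : 'I_#|C0|) := [set z | (0 < hom_count z (enum_val i))%N].
pose h i := #|down i|.
have h_le i j : (0 < hom_count (enum_val i) (enum_val j))%N ->
    (h i <= h j ?= iff (i == j))%N.
  move=> ij; have down_ij : down i \subset down j.
    by apply/fintype.subsetP => z; rewrite !inE => zi; exact: hom_count_trans zi ij.
  have [hij hE] := subset_leqif_card down_ij; split=> //; rewrite /h hE.
  apply/idP/eqP => [ji|-> //]; apply/enum_val_inj/hom_count_antisym => //.
  have := fintype.subsetP ji (enum_val j); rewrite !inE; apply.
  by rewrite hom_count_self.
rewrite /determinant (bigD1 (1%g : 'S_#|C0|)) //= [X in _ + X]big1 => [|s s1].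
  rewrite addr0 odd_perm1 expr0 mul1r big1 // => i _.
  by rewrite mxE perm1 -/(hom_count _ _) hom_count_self.
have [i i0|hs] := pickP (fun i => hom_count (enum_val i) (enum_val (s i)) == 0%N).
  by rewrite (bigD1 i) //= mxE -/(hom_count _ _) (eqP i0) mul0r mulr0.
case/eqP: s1; apply/permP => i; rewrite perm1.
(* As [s] permutes the indices both sums are equal, so each inequality [h i <= h (s i)] is an
   equality and [s] fixes every index. *)
have [_] : (\sum_i h i <= \sum_i h (s i) ?= iff [forall i, i == s i])%N.
  by apply: leqif_sum => j _; apply: h_le; rewrite lt0n hs.
rewrite [X in _ == X](reindex_inj (@perm_inj _ s^-1%g)) /=.
under [X in _ == X]eq_bigr do rewrite permKV.
by rewrite eqxx => /esym/forallP/(_ i)/eqP.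
Qed.

(** Only for a unit is [invmx] a genuine inverse, so this is what gives [mobius] its meaning. *)
Lemma hom_mx_unit : hom_mx ob \in unitmx.
Proof. by rewrite unitmxE det_hom_mx unitr1. Qed.

Lemma sum_hom_mobius x y :
  \sum_z (hom_count x z)%:Z * mobius ob z y = (x == y)%:R.
Proof.
have := congr1 (fun A : 'M_ _ => A (enum_rank x) (enum_rank y)) (mulmxV hom_mx_unit).
rewrite !mxE (can_eq enum_rankK) => <-.
rewrite (reindex (@enum_val C0 C0)) /=; last first.
  by exists enum_rank => z _; rewrite ?enum_rankK ?enum_valK.
by apply: eq_bigr => z _; rewrite /mobius enum_valK mxE enum_rankK.
Qed.

Lemma sum_mobius_hom x y :
  \sum_z mobius ob x z * (hom_count z y)%:Z = (x == y)%:R.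
Proof.
have := congr1 (fun A : 'M_ _ => A (enum_rank x) (enum_rank y)) (mulVmx hom_mx_unit).
rewrite !mxE (can_eq enum_rankK) => <-.
rewrite (reindex (@enum_val C0 C0)) /=; last first.
  by exists enum_rank => z _; rewrite ?enum_rankK ?enum_valK.
by apply: eq_bigr => z _; rewrite /mobius enum_valK mxE enum_rankK.
Qed.

End Mobius.

(** * Moebius inversion in a commutative ring *)

Section MobiusInversion.
Variables (R : comPzRingType) (I : finType) (h m : I -> I -> int) (l e : I -> R).
Hypothesis hm : forall x y, \sum_z h x z * m z y = (x == y)%:R.
Hypothesis mh : forall x y, \sum_z m x z * h z y = (x == y)%:R.
Hypothesis eE : forall x, e x = \sum_z l z *~ m z x.

Lemma sum_delta (f : I -> R) x : \sum_z f z *~ (z == x)%:R = f x.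
Proof.
rewrite (bigD1 x) //= eqxx mulr1z big1 ?addr0 // => z /negPf ->.
by rewrite mulr0z.
Qed.

Lemma mobius_inversion x : l x = \sum_z e z *~ h z x.
Proof.
rewrite -[LHS](sum_delta l).
under eq_bigr do rewrite -mh mulrz_sumr.
rewrite exchange_big /=; apply: eq_bigr => z _; rewrite eE mulrz_suml.
by apply: eq_bigr => u _; rewrite mulrzA.
Qed.

(** Each [e y] is a common eigenvector of multiplication by the [l z]; expanding [e x] in the [l z]
    then collapses the product. *)
Lemma mobius_orthogonal_idempotents :
  (forall x y, l x * l y = \sum_z e z *~ (h z x * h z y)) ->
  orthogonal_idempotents e.
Proof.
move=> ll x y.
(* The eigenvalue of [l z] on [e y] is [h y z]: in the expansion of [e y], the product formula and
   [hm] leave only the term [u = y]. *)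
have E z : l z * e y = e y *~ h y z.
  rewrite [in LHS]eE mulr_sumr.
  transitivity (\sum_w \sum_u e u *~ (h u z * (h u w * m w y))).
    apply: eq_bigr => w _; rewrite mulrzAr ll mulrz_suml.
    by apply: eq_bigr => u _; rewrite -mulrzA mulrA.
  rewrite exchange_big /= -[RHS](sum_delta (fun u => e u *~ h u z) y).
  by apply: eq_bigr => u _; rewrite -mulrz_sumr -mulr_sumr hm mulrzA.
rewrite {1}eE mulr_suml.
under eq_bigr do rewrite mulrzAl E -mulrzA.
by rewrite -mulrz_sumr hm eq_sym; case: eqP => [->|_].
Qed.

End MobiusInversion.

(** * The subring generated by the linearizations *)

Lemma lin_class_delta (K : fieldType) (Q : quiver) (C0 : finType)
    (ob : C0 -> qover Q) x :
  lin_class K ob (delta ob x)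
  = \sum_z rep_class (linearization K (ob z)) *~ mobius ob z x.
Proof.
rewrite /lin_class /delta raddf_sum; apply: eq_bigr => z _.
by rewrite freegZ raddfMz; congr (_ *~ _); exact: zliftU.
Qed.

(** The coefficient of [e z] counts the morphisms from [z] into the fiber product of [x] and [y],
    once through its components and once through its two projections. *)
Lemma rep_class_mul_linearization (K : fieldType) (Q : quiver) (C0 : finType)
    (ob : C0 -> qover Q) (e : C0 -> rep_ring K Q) :
  (forall x, connected_quiver (odom (ob x))) -> closed_under_fiber_products ob ->
  (forall x, rep_class (linearization K (ob x)) = \sum_z e z *~ hom_count ob z x) ->
  forall x y,
    rep_class (linearization K (ob x)) * rep_class (linearization K (ob y))
    = \sum_z e z *~ ((hom_count ob z x)%:Z * (hom_count ob z y)%:Z).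
Proof.
move=> conn fp lE x y; have [I [g fg]] := fp x y.
rewrite -rep_class_tensor (rep_class_iso (linearization_fiber_product _ _ _)).
rewrite (rep_class_iso (linearization_oiso K fg)) rep_class_disjoint_union.
under eq_bigr do rewrite lE.
rewrite exchange_big /=; apply: eq_bigr => z _; rewrite -mulrz_sumr.
rewrite /hom_count -PoszM -card_ohom_fiber_product (card_ohom_oiso _ fg).
by rewrite card_ohom_disjoint_union // (big_morph Posz PoszD (erefl 0%:Z)).
Qed.

(** * Spans and product decompositions from orthogonal idempotents *)

Section OrthogonalIdempotents.
Variables (R : comPzRingType) (I : finType) (e : I -> R).
Hypothesis e_orth : orthogonal_idempotents e.

Lemma sum_orthogonal_mul (c d : I -> int) :
  (\sum_i e i *~ c i) * (\sum_i e i *~ d i) = \sum_i e i *~ (c i * d i).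
Proof.
rewrite mulr_suml; apply: eq_bigr => i _; rewrite mulr_sumr (bigD1 i) //= big1.
  by rewrite mulrzAl mulrzAr e_orth eqxx -mulrzA_C addr0 mulrzA_C.
by move=> j /negPf ji; rewrite mulrzAl mulrzAr e_orth eq_sym ji !mul0rz.
Qed.

(** By orthogonality the integer span of the [e i] is a subring, and it contains every [l x].
    Conversely each [e x] is an integer combination of the [l z]. *)
Lemma subring_generated_span (l : I -> R) (h m : I -> I -> int) :
  (forall x, l x = \sum_z e z *~ h z x) -> (forall x, e x = \sum_z l z *~ m z x) ->
  (forall x, subring_generated (fun r => exists x, r = l x) (e x)) /\
  (forall r, subring_generated (fun r => exists x, r = l x) r ->
    exists c : {ffun I -> int}, r = \sum_i e i *~ c i).
Proof.
move=> lE eE; split=> [x|r]; last first.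
  move=> /(_ (fun r => exists c : {ffun I -> int}, r = \sum_i e i *~ c i)).
  apply; split=> [|_ [x ->]].
    split=> [|_ _ [c ->] [d ->]].
      by exists 0, 0; rewrite big1 // => i _; rewrite ffunE.
    split; first exists (c - d).
      by rewrite -sumrB; apply: eq_bigr => i _; rewrite !ffunE mulrzBr.
    exists [ffun i => c i * d i]; rewrite sum_orthogonal_mul.
    by apply: eq_bigr => i _; rewrite ffunE.
  by exists [ffun z => h z x]; rewrite lE; apply: eq_bigr => z _; rewrite ffunE.
rewrite eE => A [[[a Aa] AA] lA].
(* A subring is only known to be nonempty and closed under differences, so [0] is obtained as
   [a - a]. *)
have A0 : A 0 by rewrite -(subrr a); apply: (AA _ _ _ _).1.
have AN r : A r -> A (- r) by move=> Ar; rewrite -sub0r; apply: (AA _ _ _ _).1.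
have AD r s : A r -> A s -> A (r + s).
  by move=> Ar As; rewrite -[s]opprK; apply: (AA _ _ _ _).1 => //; exact: AN.
have AM r n : A r -> A (r *+ n).
  by move=> Ar; elim: n => // n IH; rewrite mulrS; exact: AD.
apply: (big_ind A) => // z _; have Az : A (l z) by apply: lA; exists z.
case: (m z x) => n; first exact: AM.
by rewrite NegzE mulrNz; apply/AN/AM.
Qed.

(** The map sends [r] to its components [r * e i]. The proofs [he] come first because the ring
    structures on the ideals depend on them. *)
Lemma idempotent_decomposition (e1 : \sum_i e i = 1) :
  exists (he : forall i, e i * e i = e i)
         (phi : {rmorphism R -> prod_ring (fun i => ideal_ring (he i))}),
    bijective phi /\ forall r i, val (phi r i) = r * e i.
Proof.
have he i : e i * e i = e i by rewrite e_orth eqxx.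
have mem r i : r * e i \in principal_ideal (e i) by apply/asboolP; exists r.
pose S i : comPzRingType := ideal_ring (he i).
pose f (r : R) : prod_ring S := fun i => exist _ (r * e i) (mem r i).
have fE r i : val (f r i) = r * e i by [].
have f_add : zmod_morphism f.
  move=> r s; apply: functional_extensionality_dep => i; apply: val_inj.
  by rewrite fE mulrBl.
have f_mul : monoid_morphism f.
  split=> [|r s]; apply: functional_extensionality_dep => i; apply: val_inj.
    by rewrite fE mul1r.
  by rewrite fE /= mulrACA he.
pose fA := GRing.isZmodMorphism.Build R (prod_ring S) f f_add.
pose fM := GRing.isMonoidMorphism.Build R (prod_ring S) f f_mul.
pose phi : {rmorphism R -> prod_ring S} := HB.pack f fA fM.
exists he, phi; split=> //.
(* The inverse adds up the components: one composite uses that the [e i] sum to [1], the other that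
   they are orthogonal. *)
exists (fun g : prod_ring S => \sum_i val (g i)) => [r|g].
  by under eq_bigr do rewrite fE; rewrite -mulr_sumr e1 mulr1.
apply: functional_extensionality_dep => i; apply: val_inj.
rewrite fE mulr_suml (bigD1 i) //= big1 => [|j /negPf ji].
  by have /asboolP[s ->] := valP (g i); rewrite addr0 -mulrA he.
by have /asboolP[s ->] := valP (g j); rewrite -mulrA e_orth ji mulr0.
Qed.

End OrthogonalIdempotents.

Theorem corollary10 (K : fieldType) (Q : quiver) (C0 : finType)
    (ob : C0 -> qover Q)
    (C_acyclic : acyclic ob)
    (C_connected : forall x : C0, connected_quiver (odom (ob x)))
    (C_wrapping : forall x : C0, wrapping (str (ob x)))
    (C_fiber_products : closed_under_fiber_products ob)
    (L_indecomposable : forall x : C0, indecomposable (linearization K (ob x)))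
    (L_distinct : forall x y : C0, x <> y ->
       ~ rep_iso (linearization K (ob x)) (linearization K (ob y))) :
  let e := fun x : C0 => lin_class K ob (delta ob x) in
  (orthogonal_idempotents e /\
   Z_basis
     (subring_generated
        (fun r => exists x : C0, r = rep_class (linearization K (ob x)))) e)
  /\
  ((exists x : C0, ob x = over_self Q) ->
   exists (he : forall x : C0, e x * e x = e x)
          (phi : {rmorphism rep_ring K Q ->
                            prod_ring (fun x : C0 => ideal_ring (he x))}),
     bijective phi /\
     forall (r : rep_ring K Q) (x : C0), val (phi r x) = r * e x).
Proof.
move=> e; pose l x := rep_class (linearization K (ob x)).
have eE x : e x = \sum_z l z *~ mobius ob z x by exact: lin_class_delta.
have hm := sum_hom_mobius C_acyclic; have mh := sum_mobius_hom C_acyclic.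
have lE x : l x = \sum_z e z *~ hom_count ob z x.
  exact: (mobius_inversion mh eE).
have e_orth : orthogonal_idempotents e.
  apply: (mobius_orthogonal_idempotents hm eE).
  exact: rep_class_mul_linearization.
have [e_gen e_span] := subring_generated_span e_orth lE eE.
split; first split=> //.
  split=> // r /e_span[c rE]; exists c; split=> // d rE'.
  (* The difference of two expansions of [r] is rewritten in the classes [l x], which are linearly
     independent. *)
  have cd0 x : \sum_z mobius ob x z * (c z - d z) = 0.
    move: x; apply: (@rep_class_free _ _ _ (fun x => linearization K (ob x))) => //.
    transitivity (\sum_z e z *~ (c z - d z)).
      under [RHS]eq_bigr do rewrite eE mulrz_suml.
      rewrite exchange_big /=; apply: eq_bigr => u _.
      by rewrite mulrz_sumr; apply: eq_bigr => z _; rewrite mulrzA.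
    under eq_bigr do rewrite mulrzBr.
    by rewrite sumrB -rE -rE' subrr.
  apply/ffunP => x; apply/eqP; rewrite -subr_eq0; apply/eqP.
  (* Multiplying by the matrix of hom counts undoes the Moebius matrix and recovers [c x - d x]. *)
  transitivity (\sum_u (hom_count ob x u)%:Z * (\sum_z mobius ob u z * (c z - d z))).
    under eq_bigr do rewrite mulr_sumr.
    rewrite exchange_big /= (bigD1 x) //= [X in _ = _ + X]big1 => [|z /negPf zx].
      under eq_bigr do rewrite mulrA.
      by rewrite -mulr_suml hm eqxx mul1r addr0.
    under eq_bigr do rewrite mulrA.
    by rewrite -mulr_suml hm eq_sym zx mul0r.
  by rewrite big1 // => u _; rewrite cd0 mulr0.
move=> [x0 x0E]; apply: idempotent_decomposition => //.
rewrite -rep_class_over_self -x0E -/(l x0) lE; apply: eq_bigr => z _.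
(* [(Q, id)] is terminal over [Q]: the structure map of [z] is the only morphism, so every
   coefficient is [1]. *)
suff -> : hom_count ob z x0 = 1%N by [].
apply/eqP/fintype1P; rewrite x0E.
have sP : qcomp (str (over_self Q)) (str (ob z)) == str (ob z).
  by apply/eqP/qmorP => u; rewrite ?(mvertE, marrE) /= ?(mvertE, marrE).
exists (exist _ (str (ob z)) sP) => f; apply: ohomP => u /=.
  by rewrite -(mvert_ohom f) mvertE.
by rewrite -(marr_ohom f) marrE.
Qed.
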